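(* Let $(Y_t)_{t\ge 0}$ be the locally-balanced Markov jump process (LBMJP) with balancing function $g$, base kernel $\gamma$ and target distribution $\pi$, with jump rate $\lambda$ and embedded chain $X=(X_n)_{n\ge 0}$ with transition kernel $\Gamma_g$. Assume: (1) $\lambda(x)>0$ for all $x\in\mathrm{supp}(\pi)$; (2) $g$ is non-decreasing and continuous on $[0,\infty)$; (3) there is a non-trivial measure $\phi$ on $(E,\mathcal{E})$ such that for all $x\in\mathrm{supp}(\pi)$ and all $B\in\mathcal{E}$ with $\phi(B)>0$ there exists $n\in\mathbb{N}$ with $\mathbb{P}_x(X_n\in B)>0$; (4) for all $x\in\mathrm{supp}(\pi)$ and all $A\in\mathcal{E}$ with $\pi(A)=0$, $\Gamma_g(x,A)=0$. Let $n_T$ be the number of jumps of $Y$ until time $T$, and let $S\in\mathcal{E}$ be a set with $\pi(S)=1$ such that $\mathbb{E}_x[n_T]<\infty$ for all $T>0$ and $x\in S$. Then for any bounded (measurable) $f:E\to\mathbb{R}$ and any $x\in\mathrm{supp}(\pi)\cap S$, the process $$M_t=f(Y_t)-f(x)-\int_0^t Lf(Y_s)\,ds,\qquad t\ge0,$$ with $Y_0=x$ is a martingale with respect to the natural filtration of $Y$. Therefore the domain $\mathcal{D}(L)$ of the weak generator of $Y$ contains all bounded functions $\mathcal{B}(E)$, and the weak generator of the LBMJP restricted to $\mathcal{B}(E)$ is the operator $L$.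
   Context: Let $E$ be a Polish space with Borel $\sigma$-algebra $\mathcal{E}$, $\pi$ a probability measure on $(E,\mathcal{E})$ with topological support $\mathrm{supp}(\pi)$, and $\gamma:E\times\mathcal{E}\to[0,1]$ a Markov kernel. Write $[\pi\otimes\gamma](dx,dy)=\pi(dx)\gamma(x,dy)$. The function $t:E\times E\to[0,\infty)$ is a version of the Radon--Nikodym derivative $t(x,y)=\frac{\pi(dy)\gamma(y,dx)}{\pi(dx)\gamma(x,dy)}$ such that, for some measurable $R\subset E\times E$ with $[\pi\otimes\gamma](R)=1$, one has $0<t(x,y)<\infty$ and $t(y,x)=1/t(x,y)$ for $(x,y)\in R$, and $t(x,y)=0$ for $(x,y)\notin R$. A balancing function is a (Borel) function $g:[0,\infty)\to[0,\infty)$ with $g(1)=1$, $g(0)=0$, $g(s)>0$ for $s>0$, and $g(s)=s\,g(1/s)$ for all $s>0$. Jump rate: $\lambda(x)=\int_E g(t(x,y))\,\gamma(x,dy)\in[0,\infty]$. Embedded kernel: $\Gamma_g(x,A)=\int_A \frac{g(t(x,y))}{\lambda(x)}\,\gamma(x,dy)$ (at degenerate points, where $\lambda(x)\in\{0,\infty\}$, set $\Gamma_g(x,\cdot)=\delta_x$), and $\Gamma_gf(x)=\int f(y)\Gamma_g(x,dy)$. LBMJP started from $x\in\mathrm{supp}(\pi)$: let $X=(X_n)_{n\ge0}$ be the discrete-time Markov chain with $X_0=x$ and transition kernel $\Gamma_g$; given $X$, let $\tau_n\sim\mathrm{Exp}(\lambda(X_{n-1}))$, $n\ge1$, be conditionally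 independent ($\mathrm{Exp}(0)$ means $+\infty$, $\mathrm{Exp}(\infty)$ means $0$); set $T_0=0$, $T_n=\sum_{k=1}^n\tau_k$. Then $Y_t=X_{\sup\{n:T_n\le t\}}$ if $t<\sup_n T_n$, and $Y_t=\partial$ (a graveyard state) otherwise. $\mathbb{P}_x,\mathbb{E}_x$ refer to the process started from $x$. The number of jumps until time $T$ is $n_T=\sup\{n:T_n\le T\}$. For bounded $f:E\to\mathbb{R}$, $Lf(x)=\int_E g(t(x,y))\,(f(y)-f(x))\,\gamma(x,dy)=\lambda(x)(\Gamma_gf(x)-f(x))$. Weak generator: $f$ belongs to its domain, with image $Lf$, when $f(Y_t)-f(Y_0)-\int_0^tLf(Y_s)\,ds$ is a martingale in the natural filtration of $Y$ (for the starting points $x\in\mathrm{supp}(\pi)\cap S$ considered). $\mathcal{B}(E)$ is the set of bounded (measurable) functions $E\to\mathbb{R}$. *)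

(* Defs.v *)
From HB Require Import structures.
From mathcomp Require Import all_boot all_order all_algebra.
From mathcomp Require Import all_classical all_reals all_analysis.
From mathcomp Require Import measurable_realfun.

Set Implicit Arguments.
Unset Strict Implicit.
Unset Printing Implicit Defensive.

Import Order.TTheory GRing.Theory Num.Theory.
Import numFieldNormedType.Exports.

Local Open Scope classical_set_scope.
Local Open Scope ring_scope.
Local Open Scope ereal_scope.

Notation borel E := (g_sigma_algebraType (@open E)).

(* Together with a complete metric on the carrier, this says that the space is
   Polish. *)
Definition separable_space (T : topologicalType) : Prop :=
  exists2 D : set T, countable D & dense D.

Definition msupport {R : realType} (E : ptopologicalType)
    (pi : {measure set (borel E) -> \bar R}) : set E :=
  [set x | forall U : set E, open_nbhs x U -> 0 < pi U].

(* Functions [0, oo) -> [0, oo) are represented by functions on R whose values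
   on negative numbers are irrelevant. *)
Record balancing_function {R : realType} (g : R -> R) : Prop := {
  balancing_measurable : measurable_fun (`[0%R, +oo[%classic : set R) g ;
  balancing1 : g 1%R = 1%R ;
  balancing0 : g 0%R = 0%R ;
  balancing_gt0 : forall s : R, (0 < s)%R -> (0 < g s)%R ;
  balancingV : forall s : R, (0 < s)%R -> g s = (s * g s^-1)%R }.

Section joint_measure.
Context {R : realType} d (E : measurableType d).
Variables (pi : probability E R) (gamma : R.-pker E ~> E).

(* [pi \otimes gamma](dx, dy) = pi(dx) gamma(x, dy) *)
Definition joint (A : set (E * E)) : \bar R :=
  \int[pi]_x gamma x (xsection A x).

Let joint0 : joint set0 = 0.
Proof. by apply: integral0_eq => x _; rewrite xsection0 measure0. Qed.

Let joint_ge0 A : 0 <= joint A.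
Proof. exact: integral_ge0. Qed.

Let joint_sigma_additive : semi_sigma_additive joint.
Proof.
move=> F mF tF mUF; rewrite /joint.
rewrite (_ : \int[pi]_x _ =
    \int[pi]_x \sum_(0 <= n <oo) gamma x (xsection (F n) x)); last first.
  apply: eq_integral => x _; rewrite xsection_bigcup.
  apply/esym/cvg_lim => //.
  apply: (@measure_semi_sigma_additive _ _ _ (gamma x)).
  - by move=> n; exact: measurable_xsection.
  - exact: trivIset_xsection.
  - by apply: bigcup_measurable => n _; exact: measurable_xsection.
rewrite integral_nneseries//; last first.
  by move=> n; exact: measurable_fun_xsection_finite_kernel (mem_set (mF n)).
by apply: is_cvg_ereal_nneg_natsum => n _; exact: integral_ge0.
Qed.

HB.instance Definition _ := isMeasure.Build _ _ _ joint
  joint0 joint_ge0 joint_sigma_additive.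

(* t is a version of pi(dy) gamma(y, dx) / (pi(dx) gamma(x, dy)). *)
Definition is_balance_ratio (t : E * E -> R) : Prop :=
  [/\ measurable_fun setT t,
      forall z, (0 <= t z)%R,
      forall A, measurable A ->
        joint ((fun z => (z.2, z.1)) @^-1` A) = \int[joint]_(z in A) (t z)%:E &
      exists2 D : set (E * E), measurable D /\ joint D = 1 &
        (forall z, D z -> (0 < t z /\ t (z.2, z.1) = (t z)^-1)%R) /\
        (forall z, ~ D z -> t z = 0%R)].

End joint_measure.

Section jump_kernel.
Context {R : realType} d (E : measurableType d).
Variables (gamma : R.-pker E ~> E) (t : E * E -> R) (g : R -> R).

Definition jump_rate (x : E) : \bar R := \int[gamma x]_y (g (t (x, y)))%:E.

Definition embedded_kernel (x : E) (A : set E) : \bar R :=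
  if (0 < jump_rate x) && (jump_rate x < +oo)
  then \int[gamma x]_(y in A) (g (t (x, y)) / fine (jump_rate x))%:E
  else \d_x A.

Definition generator (f : E -> R) (x : E) : R :=
  (\int[gamma x]_y (g (t (x, y)) * (f y - f x)))%R.

End jump_kernel.

(* The exponential distribution on [0, +oo], with Exp(0) = +oo and
   Exp(+oo) = 0. *)
Definition exp_law {R : realType} (r : \bar R) (B : set (\bar R)) : \bar R :=
  if r == 0 then \d_(+oo : \bar R) B
  else if r == +oo then \d_(0 : \bar R) B
  else exponential_prob (fine r) (EFin @^-1` B).

(* The sigma-algebra generated by the Z i, i \in D, when G generates the
   sigma-algebra of the codomain. *)
Definition sigma_of {I Omega T : Type} (D : set I) (Z : I -> Omega -> T)
    (G : set (set T)) : set (set Omega) :=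
  <<s \bigcup_(i in D) preimage_set_system setT (Z i) G >>.

Section process.
Context {R : realType} d (E : measurableType d) (Omega : Type).
Variables (X : nat -> Omega -> E) (tau : nat -> Omega -> \bar R).

(* The holding times are tau 1, tau 2, ...; tau 0 is not used. *)
Definition jump_time (n : nat) (w : Omega) : \bar R :=
  \sum_(1 <= k < n.+1) tau k w.

Definition jump_count (T : R) (w : Omega) : \bar R :=
  ereal_sup [set n%:R%:E | n in [set n | jump_time n w <= T%:E]].

(* None is the graveyard state. *)
Definition jump_process (s : R) (w : Omega) : option E :=
  if s%:E < ereal_sup (range (jump_time ^~ w))
  then Some (X (supremum 0%N [set n | jump_time n w <= s%:E]) w)
  else None.

End process.

(* The law of (X, tau) for a chain started from x: X is a Markov chain with
   kernel Gamma_g, and given X the tau k, k >= 1, are independent with law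
   Exp(lambda(X_(k-1))). Both conditional laws are stated by integration over
   the events of the conditioning sigma-algebra. *)
Record is_lbmjp {R : realType} d (E : measurableType d) d'
    (Omega : measurableType d') (gamma : R.-pker E ~> E) (t : E * E -> R)
    (g : R -> R) (X : nat -> Omega -> E) (tau : nat -> Omega -> \bar R)
    (x : E) (P : probability Omega R) : Prop := {
  lbmjp_start : {ae P, forall w, X 0%N w = x} ;
  lbmjp_chain : forall (n : nat) (F : set Omega) (A : set E),
    sigma_of [set k | (k <= n)%N] X measurable F -> measurable A ->
    P (F `&` X n.+1 @^-1` A) =
    \int[P]_(w in F) embedded_kernel gamma t g (X n w) A ;
  lbmjp_times : forall (n : nat) (F : set Omega) (B : nat -> set (\bar R)),
    sigma_of setT X measurable F -> (forall k, measurable (B k)) ->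
    P (F `&` \bigcap_(k in [set k | (1 <= k <= n)%N]) tau k @^-1` B k) =
    \int[P]_(w in F)
      \big[mule/1]_(1 <= k < n.+1) exp_law (jump_rate gamma t g (X k.-1 w)) (B k)
}.

(* The sigma-algebra on option E is generated by the measurable subsets of E;
   {None} is the complement of their union. *)
Definition natural_filtration {R : realType} d (E : measurableType d)
    (Omega : Type) (Y : R -> Omega -> option E) (s : R) : set (set Omega) :=
  sigma_of [set r | (0 <= r <= s)%R] Y [set Some @` A | A in measurable].

(* Time ranges over [0, oo); the last clause is E[M_u | F_s] = M_s. *)
Definition martingale {R : realType} d (Omega : measurableType d)
    (P : probability Omega R) (F : R -> set (set Omega))
    (M : R -> Omega -> R) : Prop :=
  [/\ forall s, (0 <= s)%R -> forall B : set R, measurable B ->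
        F s (M s @^-1` B),
      forall s, (0 <= s)%R -> P.-integrable setT (EFin \o M s) &
      forall s u, (0 <= s <= u)%R -> forall A, F s A ->
        \int[P]_(w in A) (M u w)%:E = \int[P]_(w in A) (M s w)%:E].

(* Functions on E are extended by 0 at the graveyard state. *)
Definition additive_functional {R : realType} (E Omega : Type)
    (Y : R -> Omega -> option E) (h : E -> R) (s : R) (w : Omega) : R :=
  (\int[lebesgue_measure]_(r in `[0%R, s]) oapp h 0%R (Y r w))%R.

Section weak_generator.
Context {R : realType} d (E : measurableType d) d' (Omega : measurableType d').
(* S0 is the set of starting points considered. *)
Variables (P : E -> probability Omega R) (Y : R -> Omega -> option E).
Variable S0 : set E.

(* The graph of the weak generator: f is in the domain, with image h. *)
Definition weak_generator (f h : E -> R) : Prop :=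
  forall x, S0 x ->
    martingale (P x) (natural_filtration Y) (fun s w =>
      oapp f 0%R (Y s w) - oapp f 0%R (Y 0%R w)
        - additive_functional Y h s w)%R.

Definition weak_domain : set (E -> R) :=
  [set f | exists h, weak_generator f h].

End weak_generator.

Definition bounded_measurable (R : realType) {d} (E : measurableType d) :
    set (E -> R) :=
  [set f : E -> R | measurable_fun setT f /\ bounded_fun f].
Arguments bounded_measurable R {d} E _.

(* Main.v *)
Require Import Defs.
From HB Require Import structures.
From mathcomp Require Import all_boot all_order all_algebra.
From mathcomp Require Import all_classical all_reals all_analysis.
From mathcomp Require Import measurable_realfun.
From mathcomp Require Import ring lra.
Import Order.TTheory GRing.Theory Num.Theory.
Import numFieldNormedType.Exports.
Local Open Scope classical_set_scope.
Local Open Scope ring_scope.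
Local Open Scope ereal_scope.

Set Implicit Arguments.
Unset Strict Implicit.
Unset Printing Implicit Defensive.

(** The martingale splits along the jumps. Let T_n be the jump times, tau_n the
    holding times, lambda the jump rate and Gamma the embedded kernel. Up to
    explosion, [path_jumps] and [path_integral] give

      f(Y_u) - f(X_0) - int_0^u Lf(Y_r) dr = sum_n I_n(u),

    where the increment contributed by the n-th state is

      I_n(u) = 1[T_(n+1) <= u] (f(X_(n+1)) - f(X_n))
               - Lf(X_n) (min(T_(n+1), u) - min(T_n, u)).

    Each I_n is a martingale, for two reasons.

    - Given X_0, ..., X_n and tau_1, ..., tau_n, the holding time tau_(n+1) is
      Exp(lambda(X_n)), and X_(n+1) is drawn from Gamma(X_n) whatever tau_(n+1)
      is ([cond_law_hold], [cond_law_chain]). An exponential time tau of rate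
      r satisfies r E[min(tau, v)] = P(tau <= v), so the time spent in X_n,
      multiplied by lambda(X_n), compensates the indicator of the jump. As
      Lf = lambda (Gamma f - f), the mean of I_n(u) over any event of this past
      is zero ([expected_increment]). Rates 0 and +oo contribute nothing:
      at rate 0 there is no jump and Lf vanishes, while at rate +oo no time is
      spent and the embedded chain stays where it is.

    - Before the time T_(n+1), the path up to a time s is a function of
      X_0, ..., X_n and T_1, ..., T_n. Hence an event of F_s, the natural
      filtration of Y at time s, coincides on [s < T_(n+1)] with an event of the
      past above ([natural_filtration_before_jump]), while off [s < T_(n+1)] the
      increment is frozen: I_n(u) = I_n(s) for s <= u. So I_n(u) - I_n(s) has
      mean zero over the events of F_s ([martingale_of_increments]).

    To sum over n, take 0 <= f <= c, to which a bounded f is reduced by adding a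
    constant. Then |I_n(u)| is at most c (1[T_(n+1) <= u] + lambda(X_n)
    (min(T_(n+1), u) - min(T_n, u))), of mean at most 2 c P(T_(n+1) <= u), and
    these bounds sum to 2 c E[n_u]. Finiteness of the expected number of
    jumps therefore gives dominated convergence, and also excludes explosion.

    It remains to see that int_0^s Lf(Y_r) dr is measurable for F_s. The paths of
    Y stay constant for some time after each instant, so Y is progressively
    measurable and Tonelli applies ([measurable_additive_functional]). Finally
    f(Y_0) = f(X_0) almost surely ([initial_value]), which turns the martingale
    started from f(x) into the one that defines the weak generator. *)

(** * Disintegration along a conditional law *)

Section constant_kernel.
Context d d' (X : measurableType d) (Y : measurableType d') (R : realType).
Variable mu : probability Y R.

Definition kconst (x : X) : {measure set Y -> \bar R} := mu.

Let measurable_kconst U :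
  measurable U -> measurable_fun [set: X] (kconst ^~ U).
Proof. by move=> mU; exact: measurable_cst. Qed.

HB.instance Definition _ := isKernel.Build _ _ _ _ _ kconst measurable_kconst.

Let kconstT x : kconst x setT = 1. Proof. exact: probability_setT. Qed.

HB.instance Definition _ := Kernel_isProbability.Build _ _ _ _ _ kconst kconstT.

End constant_kernel.

Section pullback_kernel.
Context d d' d'' (W : measurableType d) (X : measurableType d')
  (Y : measurableType d'') (R : realType).
Variables (k : R.-pker X ~> Y) (f : W -> X).

Definition kpullback of measurable_fun setT f :=
  fun w => k (f w) : {measure set Y -> \bar R}.

Hypothesis mf : measurable_fun setT f.

Let measurable_kpullback U :
  measurable U -> measurable_fun [set: W] (kpullback mf ^~ U).
Proof.
move=> mU.
by apply: (measurableT_comp (measurable_kernel k U mU) mf).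
Qed.

HB.instance Definition _ :=
  isKernel.Build _ _ _ _ _ (kpullback mf) measurable_kpullback.

Let kpullbackT w : kpullback mf w setT = 1.
Proof. exact: prob_kernel. Qed.

HB.instance Definition _ :=
  Kernel_isProbability.Build _ _ _ _ _ (kpullback mf) kpullbackT.

End pullback_kernel.

Section graph_kernel.
Context d d' (W : measurableType d) (T : measurableType d') (R : realType).
Variable k : R.-pker W ~> T.

(** The law of the pair (w, Z) when Z is drawn from [k w]. *)
Definition kgraph (w : W) : {measure set (W * T) -> \bar R} :=
  measure_function_pushforward__canonical__measure_function_Measure
    (k w) (pair1_measurable w).

Lemma kgraphE w U : kgraph w U = k w (xsection U w).
Proof.
rewrite /kgraph /= /pushforward; congr (k w _).
by apply/seteqP; split=> z; rewrite /xsection /= inE.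
Qed.

Let measurable_kgraph U :
  measurable U -> measurable_fun [set: W] (kgraph ^~ U).
Proof.
move=> mU; rewrite (_ : kgraph ^~ U = fun w => k w (xsection U w)).
  by apply: measurable_fun_xsection_finite_kernel; rewrite inE.
by apply/funext => w; rewrite kgraphE.
Qed.

HB.instance Definition _ :=
  isKernel.Build _ _ _ _ _ kgraph measurable_kgraph.

Let kgraphT w : kgraph w setT = 1.
Proof. by rewrite /kgraph /= /pushforward preimage_setT; exact: prob_kernel. Qed.

HB.instance Definition _ :=
  Kernel_isProbability.Build _ _ _ _ _ kgraph kgraphT.

End graph_kernel.

Section disintegration.
Context d dW dT (Omega : measurableType d) (W : measurableType dW)
  (T : measurableType dT) (R : realType).
Variables (P : probability Omega R) (V : Omega -> W) (Z : Omega -> T).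
Hypotheses (mV : measurable_fun setT V) (mZ : measurable_fun setT Z).
Variable k : R.-pker W ~> T.
Hypothesis condP : forall F D, measurable F -> measurable D ->
  P (V @^-1` F `&` Z @^-1` D) = \int[P]_(w in V @^-1` F) k (V w) D.

Let VZ w := (V w, Z w).

Let mVZ : measurable_fun setT VZ.
Proof. exact: measurable_fun_pair. Qed.

(* [P] will be a kernel from the one-point space, so that drawing [V] and then [Z]
   becomes a composition of kernels. *)
Let k' := kpullback (kgraph k) (measurableT_comp mV (@measurable_snd _ _ unit Omega)).

(** Both sides integrate [Phi] against finite measures on [W * T], the law of
    [(V, Z)] and the law of [V] followed by a draw from [k], which agree on
    rectangles by [condP]. Taking for [W] the space [Omega] with a coarser
    sigma-algebra and for [V] the identity, this says that what is known may be
    treated as a constant while the rest is integrated out. *)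
Lemma ge0_integral_disintegration (Phi : W * T -> \bar R) :
  (forall z, 0 <= Phi z) -> measurable_fun setT Phi ->
  \int[P]_w Phi (V w, Z w) = \int[P]_w \int[k (V w)]_z Phi (V w, z).
Proof.
move=> Phi0 mPhi.
pose m1 : {measure set (W * T) -> \bar R} :=
  measure_function_pushforward__canonical__measure_function_Measure P mVZ.
pose m2 := mkcomp (kconst P) k' tt.
have m12 U : measurable U -> m1 U = m2 U.
  pose C := [set A `*` B | A in @measurable _ W & B in @measurable _ T].
  apply: (measure_unique C (fun=> setT)).
  - exact: measurable_prod_measurableType.
  - move=> _ _ [X1 mX1 [X2 mX2 <-]] [Y1 mY1 [Y2 mY2 <-]].
    exists (X1 `&` Y1); first exact: measurableI.
    by exists (X2 `&` Y2); [exact: measurableI|rewrite setXI].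
  - by move=> _; exists setT => //; exists setT => //; rewrite setXTT.
  - by rewrite bigcup_const//; exists 0%N.
  - move=> _ [F mF [D mD <-]]; rewrite /m1 /= /pushforward.
    rewrite (_ : _ @^-1` _ = V @^-1` F `&` Z @^-1` D)// condP//.
    rewrite /m2 /= /kcomp /= [LHS]integral_mkcond/=.
    apply: eq_integral => w _; rewrite patchE /k' /kpullback kgraphE /=.
    case: ifPn => [|]; rewrite ?inE ?notin_setE/= => Fw.
      by rewrite in_xsectionX// inE.
    by rewrite notin_xsectionX ?measure0// notin_setE.
  - by move=> _; rewrite /m1 /= /pushforward preimage_setT probability_setT ltry.
rewrite -[LHS]/(\int[P]_w (Phi \o VZ) w).
transitivity (\int[m1]_z Phi z).
  by rewrite (@ge0_integral_pushforward _ _ _ _ _ VZ mVZ P setT Phi)// preimage_setT.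
transitivity (\int[m2]_z Phi z).
  by apply: eq_measure_integral => U mU _; exact: m12.
rewrite integral_kcomp//; apply: eq_integral => w _.
rewrite /k' /kpullback /kgraph /=.
by rewrite (@ge0_integral_pushforward _ _ _ _ _ (pair (V w)))// preimage_setT.
Qed.

End disintegration.

(** * Densities, and taking out what is known *)

Section density.
Context d (T : measurableType d) (R : realType).
Variables (mu : {measure set T -> \bar R}) (p : T -> \bar R).

Definition density (A : set T) := \int[mu]_(w in A) p w.

Hypotheses (mp : measurable_fun setT p) (p0 : forall w, 0 <= p w).

Let density0 : density set0 = 0.
Proof. exact: integral_set0. Qed.

Let density_ge0 A : 0 <= density A.
Proof. exact: integral_ge0. Qed.

Let density_sigma_additive : semi_sigma_additive density.
Proof.
move=> F mF tF mUF; apply: cvg_toP.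
  by apply: is_cvg_nneseries => n _ _; exact: integral_ge0.
by rewrite /density ge0_integral_bigcup//=; exact: measurable_funTS.
Qed.

HB.instance Definition _ := isMeasure.Build _ _ _
  density density0 density_ge0 density_sigma_additive.

Definition density_measure : {measure set T -> \bar R} := density.

Hypothesis fin_p : forall w, p w \is a fin_num.

Import HBNNSimple.

Let integral_density_nnsfun (f : {nnsfun T >-> R}) :
  \int[density_measure]_w (f w)%:E = \int[mu]_w ((f w)%:E * p w).
Proof.
have mr r : measurable_fun setT (p \_ (f @^-1` [set r])).
  by apply/measurable_restrict => //; exact: measurable_funTS.
have pr0 r w : 0 <= (p \_ (f @^-1` [set r])) w by exact: erestrict_ge0.
have rp0 r w : 0 <= r%:E * (p \_ (f @^-1` [set r])) w.
  have [r0|r0] := leP 0%R r; first by rewrite mule_ge0// lee_fin.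
  by rewrite preimage_nnfun0// patch_set0 mule0.
under eq_integral do rewrite fimfunE -fsumEFin//.
rewrite ge0_integral_fsum//; last 2 first.
- by move=> r; exact/measurable_EFinP/measurableT_comp.
- by move=> r z _; rewrite EFinM nnfun_muleindic_ge0.
transitivity (\int[mu]_w \sum_(r \in range f)
    (r%:E * (p \_ (f @^-1` [set r])) w)); last first.
  apply: eq_integral => w _; rewrite fimfunE -fsumEFin//.
  rewrite ge0_mule_fsuml; last by move=> r; exact: nnfun_muleindic_ge0.
  apply: eq_fsbigr => r _; rewrite EFinM -muleA; congr (_ * _).
  by rewrite patchE indicE; case: ifPn => _; rewrite ?mul1e ?mul0e.
rewrite ge0_integral_fsum//; last by move=> r; exact: measurable_funeM.
apply: eq_fsbigr => r _.
have [r0|r0] := leP 0%R r.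
  rewrite ge0_integralZl// -integral_mkcond.
  under eq_integral do rewrite EFinM.
  rewrite ge0_integralZl//; last exact/measurable_EFinP/measurable_indic.
  by rewrite integral_indic// setIT.
under eq_integral do rewrite preimage_nnfun0// indic0 mulr0.
under [RHS]eq_integral do rewrite preimage_nnfun0// patch_set0 mule0.
by rewrite !integral0.
Qed.

(** Simple functions first, then monotone convergence. *)
Lemma ge0_integral_density (phi : T -> \bar R) :
  (forall w, 0 <= phi w) -> measurable_fun setT phi ->
  \int[density_measure]_w phi w = \int[mu]_w (phi w * p w).
Proof.
move=> phi0 mphi; pose f := nnsfun_approx measurableT mphi.
have mf n : measurable_fun setT (EFin \o f n) by exact/measurable_EFinP.
have f0 n w : 0 <= (f n w)%:E by rewrite lee_fin.
have nd_f w : {homo EFin \o f^~ w : m n / (m <= n)%N >-> m <= n}.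
  by move=> m n mn; rewrite lee_fin; exact/lefP/nd_nnsfun_approx.
have cvg_f w : EFin \o f^~ w @ \oo --> phi w by exact: cvg_nnsfun_approx.
transitivity (limn (fun n => \int[density_measure]_w (f n w)%:E)).
  rewrite -monotone_convergence//; last by move=> w _; exact: nd_f.
  by apply: eq_integral => w _; apply/esym/cvg_lim => //; exact: cvg_f.
transitivity (limn (fun n => \int[mu]_w ((f n w)%:E * p w))).
  by congr (limn _); apply/funext => n; exact: integral_density_nnsfun.
rewrite -monotone_convergence//.
- apply: eq_integral => w _; apply/cvg_lim => //.
  by apply: cvgeZr; [exact: fin_p|exact: cvg_f].
- by move=> n; apply: emeasurable_funM => //; exact: mf.
- by move=> n w _; exact: mule_ge0.
- by move=> w _ m n mn; apply: lee_wpmul2r => //; exact: nd_f.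
Qed.

End density.

Section conditional_density.
Context d (Omega : measurableType d) (R : realType).
Variables (P : {measure set Omega -> \bar R}) (p q : Omega -> \bar R).
Hypotheses (mp : measurable_fun setT p) (mq : measurable_fun setT q).
Hypotheses (p0 : forall w, 0 <= p w) (q0 : forall w, 0 <= q w).

(** The measures with densities [p] and [q] agree on a pi-system that contains the
    whole space, hence on the sigma-algebra that it generates. This is how a
    conditional expectation is checked on a generating pi-system. *)
Lemma eq_integral_g_sigma_algebra (G : set (set Omega)) :
  G `<=` measurable -> setI_closed G -> G setT -> \int[P]_w p w < +oo ->
  (forall F, G F -> \int[P]_(w in F) p w = \int[P]_(w in F) q w) ->
  forall F, <<s G >> F -> \int[P]_(w in F) p w = \int[P]_(w in F) q w.
Proof.
move=> Gm GI GT poo Gpq.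
apply: (g_sigma_algebra_measure_unique G _ (fun=> setT) _ _
  (density_measure P mp p0) (density_measure P mq q0)) => //.
by rewrite bigcup_const//; exists 0%N.
Qed.

Context dW (W : measurableType dW).
Variable V : Omega -> W.
Hypotheses (fp : forall w, p w \is a fin_num) (fq : forall w, q w \is a fin_num).
Hypothesis mV : measurable_fun setT V.
Hypothesis pq : forall F, measurable F ->
  \int[P]_(w in V @^-1` F) p w = \int[P]_(w in V @^-1` F) q w.

(** The measures with densities [p] and [q] have the same image under [V], and
    [phi \o V] is integrated against that image. With [q] a conditional
    expectation of [p] given [V], this takes out the known factor
    [phi \o V]. *)
Lemma ge0_integral_pull_out (phi : W -> \bar R) :
  (forall v, 0 <= phi v) -> measurable_fun setT phi ->
  \int[P]_w (phi (V w) * p w) = \int[P]_w (phi (V w) * q w).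
Proof.
move=> phi0 mphi.
have mphiV : measurable_fun setT (phi \o V) by exact: measurableT_comp.
have phiV0 w : 0 <= (phi \o V) w by exact: phi0.
rewrite -(ge0_integral_density P mp p0 fp phiV0 mphiV).
rewrite -(ge0_integral_density P mq q0 fq phiV0 mphiV).
have imE (m : {measure set Omega -> \bar R}) :
    \int[m]_w (phi \o V) w = \int[pushforward m V]_v phi v.
  by rewrite (ge0_integral_pushforward mV)// preimage_setT.
rewrite !imE.
apply: (@eq_measure_integral _ _ _ _
  (measure_function_pushforward__canonical__measure_function_Measure _ mV)
  (measure_function_pushforward__canonical__measure_function_Measure _ mV)).
by move=> F mF _; exact: pq.
Qed.

End conditional_density.

(** * Exponential holding times *)

Section exponential_law.
Context {R : realType}.
Variable r : \bar R.
Hypothesis r0 : 0 <= r.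

Local Notation law := (exp_law r : set (\bar R) -> \bar R).

Let fine_gt0 : r != 0 -> r != +oo -> (0 < fine r)%R.
Proof.
move=> rn0 roo; rewrite fine_gt0//; apply/andP; split.
  by rewrite lt_neqAle eq_sym rn0.
by rewrite lt_neqAle roo leey.
Qed.

Let exp_law0 : law set0 = 0.
Proof.
rewrite /exp_law; case: ifPn => [_|rn0]; first exact: measure0.
case: ifPn => [_|roo]; first exact: measure0.
by rewrite preimage_set0 /exponential_prob integral_set0.
Qed.

Let exp_law_ge0 B : 0 <= law B.
Proof.
rewrite /exp_law; case: ifPn => [_|rn0]; first exact: measure_ge0.
case: ifPn => [_|roo]; first exact: measure_ge0.
apply: integral_ge0 => y _; rewrite lee_fin.
exact/exponential_pdf_ge0/ltW/fine_gt0.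
Qed.

Let exp_law_sigma_additive : semi_sigma_additive law.
Proof.
rewrite /exp_law; have [_|rn0] := eqVneq r 0.
  exact: (@measure_semi_sigma_additive _ _ _ \d_(+oo : \bar R)).
have [_|roo] := eqVneq r +oo.
  exact: (@measure_semi_sigma_additive _ _ _ \d_(0 : \bar R)).
have ge0 y : (0 <= exponential_pdf (fine r) y)%R.
  exact/exponential_pdf_ge0/ltW/fine_gt0.
move=> F mF tF mUF; rewrite /exponential_prob /= preimage_bigcup.
apply: cvg_toP.
  apply: is_cvg_nneseries => n _ _.
  by apply: integral_ge0 => y _; rewrite lee_fin.
rewrite ge0_integral_bigcup//=.
- by move=> n; rewrite -[X in measurable X]setTI; exact: EFin_measurable.
- apply/measurable_funTS/measurableT_comp => //.
  exact: measurable_exponential_pdf.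
- by move=> y _; rewrite lee_fin.
- apply/trivIsetP => i j _ _ ij; rewrite -preimage_setI.
  by have /trivIsetP/(_ i j Logic.I Logic.I ij) -> := tF; rewrite preimage_set0.
Qed.

HB.instance Definition _ := isMeasure.Build _ _ _
  law exp_law0 exp_law_ge0 exp_law_sigma_additive.

Let exp_lawT : law setT = 1.
Proof.
rewrite /exp_law; case: ifPn => [_|rn0]; first by rewrite diracT.
case: ifPn => [_|roo]; first by rewrite diracT.
by rewrite preimage_setT /exponential_prob integral_exponential_pdf// fine_gt0.
Qed.

HB.instance Definition _ := @Measure_isProbability.Build _ _ R law exp_lawT.

Definition exp_measure : probability (\bar R) R := law.

Section positive_rate.
Hypotheses (rn0 : r != 0) (roo : r != +oo).

Let exp_lawE B : law B = exponential_prob (fine r) (EFin @^-1` B).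
Proof. by rewrite /exp_law (negbTE rn0) (negbTE roo). Qed.

Let exp_law_le (v : R) : (0 <= v)%R ->
  law [set s | s <= v%:E] =
  \int[lebesgue_measure]_(y in `[0%R, v]) (exponential_pdf (fine r) y)%:E.
Proof.
move=> v0; rewrite exp_lawE /exponential_prob.
rewrite [LHS]integral_mkcond [RHS]integral_mkcond; apply: eq_integral => y _.
rewrite !patchE; have [y0|y0] := ltP y 0%R.
  by rewrite lt0_exponential_pdf// !if_same.
congr (if _ then _ else _); apply/idP/idP; rewrite !inE/= in_itv/= lee_fin.
  by rewrite y0.
by case/andP.
Qed.

Let exp_law_gt (v : R) : (0 <= v)%R ->
  law [set s | v%:E < s] = (expR (- fine r * v))%:E.
Proof.
move=> v0; rewrite (_ : [set s | v%:E < s] = ~` [set s | s <= v%:E]); last first.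
  by apply/seteqP; split => s /=; [rewrite ltNge => /negP|move/negP; rewrite -ltNge].
have mle : measurable [set s : \bar R | s <= v%:E].
  by rewrite -set_itvNyc; exact: emeasurable_itv.
rewrite (@probability_setC _ _ _ exp_measure)//= exp_law_le//.
have [->|vn0] := eqVneq v 0%R.
  by rewrite set_itv1 integral_set1 mulr0 expR0 sube0.
have := @exponential_prob_itv0c _ (fine r) v; rewrite /exponential_prob => ->.
  by rewrite (_ : 1 = 1%:E)// -!EFinB subKr.
by rewrite lt_neqAle eq_sym vn0.
Qed.

Let below (s : \bar R) : set R := [set y | y%:E < s].

(** The positive part makes the identity hold for every extended real [s], and so
    keeps the integrand nonnegative when Tonelli's theorem is applied on the whole
    extended line. *)
Let layer_cake (s : \bar R) (v : R) : (0 <= v)%R ->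
  maxe 0 (mine s v%:E) =
  \int[lebesgue_measure]_(y in `[0%R, v[) (\1_(below s) y)%:E.
Proof.
move=> v0.
have mlt : measurable (below s).
  rewrite -[X in measurable X]setTI; apply: (@measurable_lte _ _ _ setT measurableT EFin (cst s)).
    exact: (@EFin_measurable R setT).
  exact: measurable_cst.
rewrite integral_indic//.
case: s mlt => [s| |] _.
- rewrite (_ : _ `&` _ = `[0%R, Num.min s v[%classic); last first.
    apply/seteqP; split => y; rewrite /below /= !in_itv/= lt_min lte_fin.
      by move=> [-> /andP[-> ->]].
    by move=> /andP[-> /andP[-> ->]].
  rewrite /= lebesgue_measure_itv/= lte_fin -EFin_min.
  have [m0|m0] := ltP 0%R (Num.min s v).
    by rewrite max_r ?lee_fin ?ltW// sube0.
  by rewrite max_l.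
- rewrite (_ : _ `&` _ = `[0%R, v[%classic); last first.
    by apply/seteqP; split => y; rewrite /below /=; [case|move=> yv; rewrite ltry].
  rewrite /= lebesgue_measure_itv/= lte_fin min_r ?leey//.
  rewrite lt_neqAle v0 andbT eq_sym; have [->|vn0] := eqVneq v 0%R => /=.
    by rewrite maxxx.
  by rewrite sube0 max_r// lee_fin.
- rewrite (_ : _ `&` _ = set0) ?measure0.
    by rewrite minNye maxeNy.
  by apply/seteqP; split => y; rewrite /below //= => -[].
Qed.

(** With S the exponential time, E[min(S, v)] is the integral of P(S > y) over
    [0, v), and r P(S > y) = r exp (- r y) is the density of S at y. *)
Lemma gt0_exp_law_trunc_mean (v : R) : (0 <= v)%R ->
  r * \int[law]_s maxe 0 (mine s v%:E) = law [set s | s <= v%:E].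
Proof.
move=> v0; rewrite exp_law_le// -integral_itv_bndo_bndc; last first.
  apply/measurable_funTS/measurable_EFinP; exact: measurable_exponential_pdf.
under eq_integral do rewrite layer_cake// integral_mkcond.
pose f (z : \bar R * R) := ((\1_(below z.1) z.2)%:E *
   (\1_`[0%R, v[ z.2)%:E) : \bar R.
have f0 z : 0 <= f z by rewrite mule_ge0.
have mf : measurable_fun setT f.
  apply: emeasurable_funM => //; apply/measurable_EFinP.
    rewrite (_ : (fun x : \bar R * R => _) = \1_[set z : \bar R * R | z.2%:E < z.1]).
      apply: measurable_indic; rewrite -[X in measurable X]setTI.
      apply: (@measurable_lte _ _ _ setT measurableT (EFin \o snd) fst) => //.
      by apply/measurable_EFinP; exact: measurable_snd.
    by apply/funext => z; rewrite !indicE.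
  apply: measurableT_comp => //; exact: measurable_indic.
have fE s : \int[lebesgue_measure]_y f (s, y) =
   \int[lebesgue_measure]_y ((fun y => (\1_(below s) y)%:E) \_ `[0%R, v[) y.
  apply: eq_integral => y _; rewrite /f /= patchE [X in _ * X%:E]indicE.
  by case: ifPn => _; rewrite ?mule1 ?mule0.
under eq_integral do rewrite -fE.
rewrite (@fubini_tonelli _ _ _ _ _ exp_measure lebesgue_measure)//=.
have mfG : measurable_fun setT (fun y => \int[exp_measure]_s f (s, y)).
  exact: (@measurable_fun_fubini_tonelli_G _ _ _ _ _ exp_measure f).
have rE : r = (fine r)%:E.
  by rewrite fineK// ge0_fin_numE// lt_neqAle roo leey.
rewrite {1}rE -ge0_integralZl//; last 2 first.
  by move=> y _; exact: integral_ge0.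
  by rewrite lee_fin fine_ge0.
rewrite [RHS]integral_mkcond; apply: eq_integral => y _; rewrite patchE.
rewrite /f /= [X in _ * \int[_]_s (_ * X%:E)]indicE.
case: ifPn => yv; last by under eq_integral do rewrite mule0; rewrite integral0 mule0.
move: yv; rewrite inE/= in_itv/= => /andP[y0 _].
under eq_integral do rewrite mule1.
rewrite (_ : \int[_]_s _ = law [set s | y%:E < s]); last first.
  have my : measurable [set s : \bar R | y%:E < s].
    rewrite -[X in measurable X]setTI.
    by apply: (@measurable_lte _ _ _ setT measurableT (cst y%:E) id).
  rewrite -[X in law X]setIT -(integral_indic exp_measure measurableT my).
  by apply: eq_integral => s _; rewrite /= !indicE; congr (_%:R%:E); apply/idP/idP; rewrite !inE.
by rewrite exp_law_gt// -EFinM exponential_pdfE.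
Qed.

End positive_rate.

(** At rate zero both sides vanish, the second one because S is infinite. *)
Lemma exp_law_trunc_mean (v : R) : (0 <= v)%R -> r != +oo ->
  (fine r)%:E * \int[law]_s maxe 0 (mine s v%:E) = law [set s | s <= v%:E].
Proof.
move=> v0 roo; have [re|rn0] := eqVneq r 0; last first.
  by rewrite -gt0_exp_law_trunc_mean// fineK// ge0_fin_numE// lt_neqAle roo leey.
by rewrite re mul0e /exp_law eqxx diracE memNset//= leye_eq.
Qed.

(** At rate +oo no time is spent. The equality of [exp_law_trunc_mean] fails there,
    since P(S <= v) = 1. *)
Lemma exp_law_trunc_meany (v : R) : (0 <= v)%R -> r = +oo ->
  \int[law]_s maxe 0 (mine s v%:E) = 0.
Proof.
move=> v0 re.
transitivity (\int[\d_(0 : \bar R)]_s maxe 0 (mine s v%:E)).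
  by apply: eq_measure_integral => B _ _; rewrite /= /exp_law re.
rewrite integral_dirac//.
  by rewrite min_l ?lee_fin// maxxx mule0.
apply: measurable_maxe => //; exact: measurable_mine.
Qed.

End exponential_law.

Section exponential_kernel.
Context d (X : measurableType d) {R : realType}.
Variable rho : X -> \bar R.

Definition kexp (rho0 : forall x, 0 <= rho x) of measurable_fun setT rho :=
  fun x => exp_measure (rho0 x) : {measure set (\bar R) -> \bar R}.

Hypotheses (rho0 : forall x, 0 <= rho x) (mrho : measurable_fun setT rho).

Let measurable_kexp B :
  measurable B -> measurable_fun [set: X] (kexp rho0 mrho ^~ B).
Proof.
move=> mB; rewrite /kexp /= /exp_law.
apply: measurable_fun_ifT; first exact: measurable_fun_eqe.
  exact: measurable_cst.
apply: measurable_fun_ifT; first exact: measurable_fun_eqe.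
  exact: measurable_cst.
pose f (z : X * R) : \bar R :=
  ((exponential_pdf (fine (rho z.1)) z.2) * \1_(EFin @^-1` B) z.2)%:E.
have f0 z : 0 <= f z.
  by rewrite lee_fin mulr_ge0// exponential_pdf_ge0// fine_ge0.
rewrite (_ : (fun x => _) = (fun x => \int[lebesgue_measure]_y f (x, y))).
  apply: measurable_fun_fubini_tonelli_F => //.
  apply/measurable_EFinP; apply: measurable_funM; last first.
    apply: measurableT_comp => //; apply: measurable_indic.
    by rewrite -[X in measurable X]setTI; exact: EFin_measurable.
  rewrite (_ : (fun _ => _) = (fun z : X * R =>
    (fine (rho z.1)) * expR (- (fine (rho z.1)) * z.2) * \1_`[0%R, +oo[ z.2)%R).
    have mfr : measurable_fun setT (fun z : X * R => fine (rho z.1)).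
      apply: (measurableT_comp (fine_measurable _)) => //.
      exact: measurableT_comp mrho measurable_fst.
    apply: measurable_funM.
      apply: measurable_funM => //; apply: measurableT_comp => //.
      by apply: measurable_funM => //; exact: measurableT_comp.
    by apply: measurableT_comp => //; exact: measurable_indic.
  apply/funext => z; rewrite /exponential_pdf patchE indicE.
  by case: ifPn => _; rewrite ?mulr1 ?mulr0.
apply/funext => x; rewrite /exponential_prob integral_mkcond.
apply: eq_integral => y _; rewrite patchE /f /= indicE.
by case: ifPn => _; rewrite ?mulr1 ?mulr0.
Qed.

HB.instance Definition _ :=
  isKernel.Build _ _ _ _ _ (kexp rho0 mrho) measurable_kexp.

Let kexpT x : kexp rho0 mrho x setT = 1.
Proof. exact: probability_setT. Qed.

HB.instance Definition _ :=
  Kernel_isProbability.Build _ _ _ _ _ (kexp rho0 mrho) kexpT.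

End exponential_kernel.

(** * The embedded kernel and the generator *)

Section jump_kernel_theory.
Context {R : realType} d (E : measurableType d).
Variables (gamma : R.-pker E ~> E) (t : E * E -> R) (g : R -> R).
Hypotheses (mgt : measurable_fun setT (g \o t)) (gt_ge0 : forall z, (0 <= g (t z))%R).

Local Notation rate := (jump_rate gamma t g).

Lemma jump_rate_ge0 x : 0 <= rate x.
Proof. by apply: integral_ge0 => y _; rewrite lee_fin. Qed.

Lemma measurable_jump_rate : measurable_fun setT rate.
Proof.
apply: (measurable_fun_integral_finite_kernel (EFin \o (g \o t))) => //.
exact/measurable_EFinP.
Qed.

Let weight x y : \bar R := (g (t (x, y)) / fine (rate x))%:E.

Let weight_ge0 x y : 0 <= weight x y.
Proof. by rewrite lee_fin divr_ge0// fine_ge0// jump_rate_ge0. Qed.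

Let mgt1 x : measurable_fun setT (fun y => g (t (x, y))).
Proof. exact: (measurableT_comp mgt (pair1_measurable x)). Qed.

Let measurable_weight x : measurable_fun setT (weight x).
Proof. by apply/measurable_EFinP; exact: measurable_funM. Qed.

(** The embedded kernel as a choice between two measures, so that it carries the
    structure of a Markov kernel. *)
Definition jump_kernel x : {measure set E -> \bar R} :=
  if (0 < rate x) && (rate x < +oo)
  then density_measure (gamma x) (measurable_weight x) (weight_ge0 x) else \d_x.

Local Notation Gamma := jump_kernel.

Lemma jump_kernelE x A : Gamma x A = embedded_kernel gamma t g x A.
Proof. by rewrite /jump_kernel /embedded_kernel; case: ifPn. Qed.

Let measurable_jump_kernel A :
  measurable A -> measurable_fun [set: E] (Gamma ^~ A).
Proof.
move=> mA; under eq_fun do rewrite jump_kernelE.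
apply: measurable_fun_ifT.
- apply: measurable_and; first exact: measurable_fun_lte measurable_jump_rate.
  exact: measurable_fun_lte measurable_jump_rate _.
- pose f (z : E * E) : \bar R := (weight z.1 z.2 * (\1_A z.2)%:E).
  rewrite (_ : (fun x => _) = (fun x => \int[gamma x]_y f (x, y))).
    apply: measurable_fun_integral_finite_kernel.
      by move=> z; rewrite mule_ge0// lee_fin.
    apply: emeasurable_funM; apply/measurable_EFinP; last first.
      by apply: measurableT_comp => //; exact: measurable_indic.
    apply: measurable_funM.
      rewrite (_ : (fun _ => _) = g \o t)//.
      by apply/funext => -[].
    (* The inverse of a nonnegative real is its power of exponent -1, and powers
       are measurable. *)
    rewrite (_ : (fun _ => _) = fun z : E * E => powR (fine (rate z.1)) (-1)).
      apply: (measurableT_comp (measurable_powR _)).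
      apply: (measurableT_comp (fine_measurable _)) => //.
      exact: measurableT_comp measurable_jump_rate _.
    by apply/funext => z; rewrite powR_inv1// fine_ge0// jump_rate_ge0.
  apply/funext => x; rewrite integral_mkcond.
  apply: eq_integral => y _; rewrite patchE /f /= indicE.
  by case: ifPn => _; rewrite ?mule1 ?mule0.
- exact: measurable_fun_dirac.
Qed.

HB.instance Definition _ :=
  isKernel.Build _ _ _ _ _ Gamma measurable_jump_kernel.

(** The factor [rate x] on both sides avoids a division in the extended reals. *)
Let int_weight x : 0 < rate x -> rate x < +oo ->
  rate x * \int[gamma x]_y weight x y = rate x.
Proof.
move=> r0 roo; rewrite /weight.
under eq_integral do rewrite EFinM.
have rfin : (0 < fine (rate x))%R by rewrite fine_gt0// r0.
have rE : rate x = (fine (rate x))%:E by rewrite fineK// ge0_fin_numE// ltW.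
rewrite ge0_integralZr//; last 3 first.
  exact/measurable_EFinP.
  by move=> y _; rewrite lee_fin.
  by rewrite lee_fin invr_ge0 ltW.
rewrite -/(rate x) {1 2 4}rE -!EFinM; congr EFin.
by rewrite mulfV ?mulr1// gt_eqF.
Qed.

Let jump_kernelT x : Gamma x setT = 1.
Proof.
rewrite jump_kernelE /embedded_kernel; case: ifPn => [/andP[r0 roo]|_].
  have rfin : (0 < fine (rate x))%R by rewrite fine_gt0// r0.
  have rE : rate x = (fine (rate x))%:E by rewrite fineK// ge0_fin_numE// ltW.
  have := int_weight r0 roo; rewrite /weight.
  set I := \int[_]_y _ => rI.
  have I0 : 0 <= I by apply: integral_ge0 => y _; exact: weight_ge0.
  have Ifin : I \is a fin_num.
    rewrite ge0_fin_numE//; apply/negPn/negP; rewrite -leNgt leye_eq => /eqP Iy.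
    by move: rI; rewrite Iy gt0_muley// => re; move: roo; rewrite -re.
  move: rI; rewrite rE -(fineK Ifin) -EFinM => -[] /eqP.
  rewrite -{2}[fine (rate x)]mulr1 => /eqP /mulfI -> //.
  by rewrite gt_eqF.
by rewrite diracT.
Qed.

HB.instance Definition _ :=
  Kernel_isProbability.Build _ _ _ _ _ Gamma jump_kernelT.

(** At rate zero the integrand vanishes almost everywhere, because
    [g (t (x, y))] is nonnegative with zero integral. *)
Lemma integral_jump_kernel x (f : E -> \bar R) : (forall y, 0 <= f y) ->
  measurable_fun setT f -> rate x < +oo ->
  \int[gamma x]_y ((g (t (x, y)))%:E * f y) = rate x * \int[Gamma x]_y f y.
Proof.
move=> f0 mf roo.
have [re0|rn0] := eqVneq (rate x) 0.
  rewrite re0 mul0e.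
  have mq : measurable_fun setT (fun y => (g (t (x, y)))%:E) by exact/measurable_EFinP.
  have gae : ae_eq (gamma x) setT (fun y => (g (t (x, y)))%:E) (cst 0).
    apply/(ae_eq_integral_abs _ _ mq) => //.
    rewrite -[RHS]re0 /jump_rate; apply: eq_integral => y _.
    by rewrite gee0_abs// lee_fin.
  rewrite (@ge0_ae_eq_integral _ _ _ (gamma x) setT _ (cst 0))//.
  - by rewrite integral0.
  - exact: emeasurable_funM.
  - by move=> y _; rewrite mule_ge0// lee_fin.
  - by apply: filterS gae => y /= -> //; rewrite mul0e.
have r0 : 0 < rate x by rewrite lt_neqAle eq_sym rn0 jump_rate_ge0.
have rfin : (0 < fine (rate x))%R by rewrite fine_gt0// r0.
have rE : rate x = (fine (rate x))%:E by rewrite fineK// ge0_fin_numE// jump_rate_ge0.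
rewrite /jump_kernel r0 roo /= ge0_integral_density// rE -ge0_integralZl//.
- apply: eq_integral => y _; rewrite muleCA muleC; congr (_ * _).
  by rewrite /weight -EFinM mulrCA divff ?mulr1// gt_eqF.
- by apply: emeasurable_funM => //; exact: measurable_weight.
- by move=> y _; rewrite mule_ge0.
- by rewrite lee_fin ltW.
Qed.

Lemma jump_kernel_degenerate x : ~~ ((0 < rate x) && (rate x < +oo)) ->
  Gamma x = \d_x :> (set E -> \bar R).
Proof. by rewrite /jump_kernel => /negbTE ->. Qed.

Lemma integral_jump_kernel_degenerate x (f : E -> \bar R) :
  measurable_fun setT f -> ~~ ((0 < rate x) && (rate x < +oo)) ->
  \int[Gamma x]_y f y = f x.
Proof.
move=> mf xd; rewrite (eq_measure_integral (\d_x : {measure set E -> \bar R})).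
  by rewrite integral_dirac// diracT mul1e.
by move=> A mA _; rewrite jump_kernel_degenerate.
Qed.

Section generator.
Variables (f : E -> R) (c : R).
Hypotheses (mf : measurable_fun setT f) (fc : forall y, (0 <= f y <= c)%R).

Lemma measurable_generator : measurable_fun setT (generator gamma t g f).
Proof.
pose h (z : E * E) : \bar R := (g (t z) * (f z.2 - f z.1))%:E.
have mh : measurable_fun setT h.
  apply/measurable_EFinP; apply: measurable_funM => //.
  by apply: measurable_funB; exact: measurableT_comp.
rewrite /generator /Rintegral.
apply: (measurableT_comp (fine_measurable _)) => //.
rewrite (_ : (fun x => _) =
  (fun x => \int[gamma x]_y h^\+ (x, y) - \int[gamma x]_y h^\- (x, y))).
  apply: emeasurable_funB.
    apply: measurable_fun_integral_finite_kernel => //.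
    exact: measurable_funepos.
  apply: measurable_fun_integral_finite_kernel => //.
  exact: measurable_funeneg.
by apply/funext => x; rewrite [LHS]integralE; congr (_ - _);
  apply: eq_integral => y _; rewrite ?funeposE ?funenegE.
Qed.

(** Finiteness of the rate is essential: at rate +oo the integral that defines the
    generator need not converge, so its value there carries no information. *)
Lemma generatorE x : rate x < +oo ->
  generator gamma t g f x =
  (fine (rate x) * (fine (\int[Gamma x]_y (f y)%:E)%E - f x))%R.
Proof.
move=> roo; rewrite /generator /Rintegral.
have f0 y : (0 <= f y)%R by case/andP: (fc y).
have rfin : rate x \is a fin_num by rewrite ge0_fin_numE// jump_rate_ge0.
have Gc : \int[Gamma x]_y (f y)%:E <= c%:E.
  have <- : \int[Gamma x]_y c%:E = c%:E.
    by rewrite integral_cst// prob_kernel mule1.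
  apply: ge0_le_integral => //.
  - by move=> y _; rewrite lee_fin.
  - exact/measurable_EFinP.
  - by move=> y _; rewrite lee_fin; case/andP: (fc y).
have G0 : 0 <= \int[Gamma x]_y (f y)%:E by apply: integral_ge0 => y _; rewrite lee_fin.
have Gfin : \int[Gamma x]_y (f y)%:E \is a fin_num.
  by rewrite ge0_fin_numE// (le_lt_trans Gc)// ltry.
have mf' : measurable_fun setT (EFin \o f) by exact/measurable_EFinP.
have f0' y : 0 <= (EFin \o f) y by rewrite lee_fin.
have gfE := integral_jump_kernel f0' mf' roo.
have ig : (gamma x).-integrable setT (fun y => (g (t (x, y)))%:E).
  apply/integrableP; split; first exact/measurable_EFinP.
  by under eq_integral do rewrite gee0_abs ?lee_fin//.
have igf : (gamma x).-integrable setT (fun y => (g (t (x, y)))%:E * (f y)%:E).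
  apply/integrableP; split.
    by apply: emeasurable_funM => //; exact/measurable_EFinP.
  under eq_integral do rewrite gee0_abs ?mule_ge0 ?lee_fin//.
  by rewrite gfE -(fineK rfin) -(fineK Gfin) -EFinM ltry.
transitivity (fine (\int[gamma x]_y ((g (t (x, y)))%:E * (f y)%:E) -
    \int[gamma x]_y ((f x)%:E * (g (t (x, y)))%:E))).
  rewrite -integralB//; last exact: integrableZl.
  congr fine; apply: eq_integral => y _.
  by rewrite -!EFinM -EFinB mulrBr [(f x * _)%R]mulrC.
rewrite gfE integralZl// -/(rate x) -(fineK rfin).
rewrite -[X in _ * X](fineK Gfin) -!EFinM -EFinB /=.
by rewrite mulrBr [(f x * _)%R]mulrC.
Qed.

End generator.

End jump_kernel_theory.

(** * Conditional laws of the next state and of the next holding time *)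

Section conditional_laws.
Context {R : realType} d (E : measurableType d) d' (Omega : measurableType d').
Variables (gamma : R.-pker E ~> E) (t : E * E -> R) (g : R -> R).
Hypotheses (mgt : measurable_fun setT (g \o t)) (gt_ge0 : forall z, (0 <= g (t z))%R).
Variables (X : nat -> Omega -> E) (tau : nat -> Omega -> \bar R).
Hypothesis mX : forall n, measurable_fun setT (X n).
Hypothesis mtau : forall n, measurable_fun setT (tau n).

Local Notation rate := (jump_rate gamma t g).
Local Notation Gamma := (jump_kernel gamma mgt gt_ge0).

Definition hold_kernel : R.-pker E ~> \bar R :=
  kexp (jump_rate_ge0 gamma gt_ge0) (measurable_jump_rate gamma mgt gt_ge0).

Definition chain_system (D : set nat) : set (set Omega) :=
  \bigcup_(i in D) preimage_set_system setT (X i) measurable.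

Definition hold_event (m : nat) (B : nat -> set (\bar R)) : set Omega :=
  \bigcap_(k in [set k | (1 <= k <= m)%N]) tau k @^-1` B k.

(** A pi-system that generates the sigma-algebra of X_0, ..., X_n and
    tau_1, ..., tau_m. The two indices are separate because tau_(n+1) is drawn
    when tau_1, ..., tau_n are known, and X_(n+1) when tau_(n+1) is known as
    well. *)
Definition past_system (n m : nat) : set (set Omega) :=
  [set A | exists F B, [/\ <<s chain_system [set k | (k <= n)%N] >> F,
     forall k, measurable (B k) & A = F `&` hold_event m B]].

Local Notation chain_space D := (g_sigma_algebraType (chain_system D)).
Local Notation past n m := (g_sigma_algebraType (past_system n m)).

Lemma measurable_hold_event m B : (forall k, measurable (B k)) ->
  measurable (hold_event m B).
Proof.
move=> mB; apply: bigcap_measurableType => k _.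
by rewrite -[X in measurable X]setTI; exact: mtau.
Qed.

Lemma chain_system_measurable D : <<s chain_system D >> `<=` measurable.
Proof.
apply: smallest_sub; first exact: sigma_algebra_measurable.
by move=> _ [i _ [A mA <-]]; exact: mX.
Qed.

Lemma chain_systemT D : <<s chain_system D >> `<=` <<s chain_system setT >>.
Proof.
apply: smallest_sub; first exact: smallest_sigma_algebra.
by move=> A [k _ kA]; apply: sub_gen_smallest; exists k.
Qed.

Lemma measurable_chain_id D : measurable_fun setT (id : Omega -> chain_space D).
Proof. by move=> _ A mA; rewrite setTI; exact: chain_system_measurable mA. Qed.

Lemma chain_measurable_fun D dU (U : measurableType dU) (h : Omega -> U) :
  measurable_fun setT (h : chain_space D -> U) -> measurable_fun setT h.
Proof.
move=> mh _ A mA; rewrite setTI; apply: (@chain_system_measurable D).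
by have := mh measurableT _ mA; rewrite setTI.
Qed.

Lemma measurable_chain (D : set nat) i : D i ->
  measurable_fun setT (X i : chain_space D -> E).
Proof.
move=> Di _ A mA; apply: sub_gen_smallest; exists i => //.
by exists A.
Qed.

Lemma past_system_measurable n m : past_system n m `<=` measurable.
Proof.
move=> _ [F [B [FX mB ->]]]; apply: measurableI.
  exact: chain_system_measurable FX.
exact: measurable_hold_event.
Qed.

Lemma past_system_setI n m : setI_closed (past_system n m).
Proof.
move=> _ _ [F [B [FX mB ->]]] [F' [B' [FX' mB' ->]]].
exists (F `&` F'), (fun k => B k `&` B' k); split.
- exact: (@measurableI _ (chain_space _)).
- by move=> k; exact: measurableI.
- rewrite setIACA; congr (_ `&` _); rewrite /hold_event.
  apply/seteqP; split => [w [wB wB'] k km|w wBB'].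
    by split; [exact: wB|exact: wB'].
  by split=> k km; have [] := wBB' k km.
Qed.

Lemma past_systemT n m : past_system n m setT.
Proof.
exists setT, (fun=> setT); split => //.
  exact: (@measurableT _ (chain_space _)).
by rewrite setTI; apply/esym/seteqP; split.
Qed.

Lemma past_measurable n m : <<s past_system n m >> `<=` measurable.
Proof.
apply: smallest_sub; first exact: sigma_algebra_measurable.
exact: past_system_measurable.
Qed.

Lemma measurable_past_id n m : measurable_fun setT (id : Omega -> past n m).
Proof. by move=> _ A mA; rewrite setTI; exact: past_measurable mA. Qed.

Lemma measurable_past_chain n m k : (k <= n)%N ->
  measurable_fun setT (X k : past n m -> E).
Proof.
move=> kn _ A mA; apply: sub_gen_smallest.
exists (setT `&` X k @^-1` A), (fun=> setT); split => //.
  exact: measurable_chain.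
by rewrite (_ : hold_event _ _ = setT) ?setIT//; apply/seteqP; split.
Qed.

Lemma measurable_past_hold n m k : (1 <= k <= m)%N ->
  measurable_fun setT (tau k : past n m -> \bar R).
Proof.
move=> km _ A mA; apply: sub_gen_smallest.
exists setT, (fun j => if j == k then A else setT); split => //.
- exact: (@measurableT _ (chain_space _)).
- by move=> j; case: ifP.
- congr (_ `&` _); apply/seteqP; split => [w wA j _ /=|w /(_ k km)/=].
    by case: eqP => // ->.
  by rewrite eqxx.
Qed.

Lemma past_systemW n m m' : (m <= m')%N ->
  <<s past_system n m >> `<=` <<s past_system n m' >>.
Proof.
move=> mm'; apply: smallest_sub; first exact: smallest_sigma_algebra.
move=> _ [F [B [FX mB ->]]]; apply: sub_gen_smallest.
exists F, (fun k => if (k <= m)%N then B k else setT); split => //.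
  by move=> k; case: ifP.
congr (_ `&` _); apply/seteqP; split => w wB k /= /andP[k1 km].
  by case: ifPn => // km0; apply: wB; rewrite /= k1.
by have := wB k; rewrite /= k1 km (leq_trans km mm') => /(_ isT).
Qed.

(** The conditional probability of [hold_event n B] given the whole chain. *)
Definition hold_weight (n : nat) (B : nat -> set (\bar R)) (w : Omega) : \bar R :=
  \big[mule/1]_(1 <= k < n.+1) exp_law (rate (X k.-1 w)) (B k).

Lemma hold_weightS n B w : hold_weight n.+1 B w =
  hold_weight n B w * hold_kernel (X n w) (B n.+1).
Proof. by rewrite /hold_weight big_nat_recr. Qed.

Lemma hold_weight_ge0 n B w : 0 <= hold_weight n B w.
Proof.
elim: n => [|n IH]; first by rewrite /hold_weight big_nil.
by rewrite hold_weightS mule_ge0.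
Qed.

Lemma hold_weight_fin n B w : (forall k, measurable (B k)) ->
  hold_weight n B w \is a fin_num.
Proof.
move=> mB; elim: n => [|n IH]; first by rewrite /hold_weight big_nil.
by rewrite hold_weightS fin_numM//; exact: finite_kernel_measure.
Qed.

(** The first [n] holding times depend on the first [n] states only. This is what
    allows the next state to be independent of them, given the states so far. *)
Lemma measurable_hold_weight (D : set nat) n B : (forall k, measurable (B k)) ->
  (forall k, (k < n)%N -> D k) ->
  measurable_fun setT (hold_weight n B : chain_space D -> \bar R).
Proof.
move=> mB; elim: n => [|n IH] nD.
  rewrite (_ : hold_weight 0 B = cst 1)//.
  by apply/funext => w; rewrite /hold_weight big_nil.
rewrite (_ : hold_weight n.+1 B =
    fun w => hold_weight n B w * hold_kernel (X n w) (B n.+1)); last first.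
  by apply/funext => w; rewrite hold_weightS.
apply: emeasurable_funM; first by apply: IH => k kn; apply: nD; exact: ltnW.
apply: (measurableT_comp (measurable_kernel hold_kernel _ (mB _))).
by apply: measurable_chain; exact: nD.
Qed.

Variables (x0 : E) (P : probability Omega R).
Hypothesis XtauP : is_lbmjp gamma t g X tau x0 P.

Let indicE_integral (F A : set Omega) : measurable F -> measurable A ->
  P (F `&` A) = \int[P]_(w in F) (\1_A w)%:E.
Proof. by move=> mF mA; rewrite integral_indic// setIC. Qed.

Let mulindic (F : set Omega) (h : Omega -> \bar R) : measurable F ->
  \int[P]_(w in F) h w = \int[P]_w ((\1_F w)%:E * h w).
Proof.
move=> mF; rewrite integral_mkcond; apply: eq_integral => w _.
by rewrite patchE indicE; case: ifPn => _; rewrite ?mul1e ?mul0e.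
Qed.

Let mXn A n : measurable A -> measurable (X n @^-1` A).
Proof. by move=> mA; rewrite -[X in measurable X]setTI; exact: mX. Qed.

(** Integrating out the next state, given the chain so far. *)
Lemma chain_pull_out n (A : set E) (phi : Omega -> \bar R) : measurable A ->
  (forall w, 0 <= phi w) ->
  measurable_fun setT (phi : chain_space [set k | (k <= n)%N] -> \bar R) ->
  \int[P]_w (phi w * (\1_(X n.+1 @^-1` A) w)%:E) =
  \int[P]_w (phi w * Gamma (X n w) A).
Proof.
move=> mA phi0 mphi.
apply: (@ge0_integral_pull_out _ _ _ P _ _ _ _ _ _ _
  (chain_space [set k | (k <= n)%N]) id) => //.
- by apply/measurable_EFinP/measurable_indic; exact: mXn.
- exact: measurableT_comp (measurable_kernel Gamma A mA) (mX n).
- by move=> w; exact: finite_kernel_measure.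
- exact: measurable_chain_id.
- move=> F FX; rewrite preimage_id.
  have mF := chain_system_measurable FX.
  rewrite -indicE_integral//; last exact: mXn.
  rewrite (lbmjp_chain XtauP FX mA).
  by apply: eq_integral => w _; rewrite -(jump_kernelE gamma mgt gt_ge0).
Qed.

(** Integrating out the first [n] holding times, given the whole chain. *)
Lemma hold_pull_out n (B : nat -> set (\bar R)) (phi : Omega -> \bar R) :
  (forall k, measurable (B k)) -> (forall w, 0 <= phi w) ->
  measurable_fun setT (phi : chain_space setT -> \bar R) ->
  \int[P]_w (phi w * (\1_(hold_event n B) w)%:E) =
  \int[P]_w (phi w * hold_weight n B w).
Proof.
move=> mB phi0 mphi.
apply: (@ge0_integral_pull_out _ _ _ P _ _ _ _ _ _ _ (chain_space setT) id) => //.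
- by apply/measurable_EFinP/measurable_indic; exact: measurable_hold_event.
- have mh : measurable_fun setT (hold_weight n B : chain_space setT -> \bar R).
    exact: measurable_hold_weight.
  exact: chain_measurable_fun mh.
- exact: hold_weight_ge0.
- by move=> w; exact: hold_weight_fin.
- exact: measurable_chain_id.
- move=> F FX; rewrite preimage_id.
  have mF := chain_system_measurable FX.
  rewrite -indicE_integral//; last exact: measurable_hold_event.
  exact: (lbmjp_times XtauP).
Qed.

(** The holding times up to tau_(n+1) bring no information on X_(n+1) beyond
    X_0, ..., X_n. On an event of the generating pi-system, the holding times are
    integrated out given the whole chain, leaving a weight that depends on
    X_0, ..., X_n only. This weight is a known factor when X_(n+1) is integrated
    out; then the holding times are put back. *)
Lemma cond_law_chain n (A : set E) F : measurable A ->
  <<s past_system n n.+1 >> F ->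
  P (F `&` X n.+1 @^-1` A) = \int[P]_(w in F) Gamma (X n w) A.
Proof.
move=> mA sF; have mXA := mXn n.+1 mA.
rewrite indicE_integral//; last exact: past_measurable sF.
apply: (eq_integral_g_sigma_algebra _ _ _ _
  (@past_system_measurable n n.+1) (@past_system_setI n n.+1)
  (past_systemT n n.+1)) sF => //.
- by apply/measurable_EFinP/measurable_indic.
- exact: measurableT_comp (measurable_kernel Gamma A mA) (mX n).
- by rewrite integral_indic// setIT (le_lt_trans (probability_le1 _ _))// ltry.
move=> {}F [F0 [B [F0X mB ->]]].
have mF0 := chain_system_measurable F0X.
have mB' : measurable (hold_event n.+1 B) by exact: measurable_hold_event.
have F0X' := chain_systemT F0X.
have mind0 : measurable_fun setT (fun w : chain_space [set k | (k <= n)%N] => ((\1_F0 w)%:E : \bar R)).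
  by apply/measurable_EFinP/measurable_indic.
have mindT : measurable_fun setT (fun w : chain_space setT => ((\1_F0 w)%:E : \bar R)).
  by apply/measurable_EFinP/measurable_indic.
(* Both sides equal this integral over the chain alone. *)
transitivity (\int[P]_w ((\1_F0 w)%:E * hold_weight n.+1 B w * Gamma (X n w) A)).
  rewrite -indicE_integral//; last exact: measurableI.
  rewrite setIAC (lbmjp_times XtauP)//; last first.
    apply: (@measurableI _ (chain_space setT)) => //.
    rewrite -[X in measurable X]setTI; exact: measurable_chain.
  rewrite mulindic; last exact: measurableI.
  rewrite -chain_pull_out//.
  - apply: eq_integral => w _; rewrite -/(hold_weight n.+1 B w).
    by rewrite indicI /= EFinM muleAC.
  - by move=> w; rewrite mule_ge0 ?hold_weight_ge0// lee_fin.
  - apply: emeasurable_funM => //; exact: measurable_hold_weight.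
transitivity (\int[P]_w ((\1_F0 w)%:E * Gamma (X n w) A * hold_weight n.+1 B w)).
  by apply: eq_integral => w _; rewrite muleAC.
rewrite -hold_pull_out//; last first.
  apply: emeasurable_funM => //.
  by apply: (measurableT_comp (measurable_kernel Gamma A mA)); exact: measurable_chain.
rewrite [RHS]mulindic; last exact: measurableI.
by apply: eq_integral => w _; rewrite indicI /= EFinM muleAC.
Qed.

(** Integrating out all holding times, the factor of [hold_weight] that belongs to
    tau_(n+1) splits off as a function of X_n; putting back the first n holding
    times leaves the conditional law of tau_(n+1). *)
Lemma cond_law_hold n (D : set (\bar R)) F : measurable D ->
  <<s past_system n n >> F ->
  P (F `&` tau n.+1 @^-1` D) = \int[P]_(w in F) hold_kernel (X n w) D.
Proof.
move=> mD sF.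
have mtD : measurable (tau n.+1 @^-1` D).
  by rewrite -[X in measurable X]setTI; exact: mtau.
rewrite indicE_integral//; last exact: past_measurable sF.
apply: (eq_integral_g_sigma_algebra _ _ _ _
  (@past_system_measurable n n) (@past_system_setI n n)
  (past_systemT n n)) sF => //.
- by apply/measurable_EFinP/measurable_indic.
- exact: measurableT_comp (measurable_kernel hold_kernel D mD) (mX n).
- by rewrite integral_indic// setIT (le_lt_trans (probability_le1 _ _))// ltry.
move=> {}F [F0 [B [F0X mB ->]]].
have mF0 := chain_system_measurable F0X.
have mB' : measurable (hold_event n B) by exact: measurable_hold_event.
have F0X' := chain_systemT F0X.
have mindT : measurable_fun setT (fun w : chain_space setT => ((\1_F0 w)%:E : \bar R)).
  by apply/measurable_EFinP/measurable_indic.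
(* The event for tau_(n+1) becomes the last constraint of a longer holding
   event. *)
pose BD k := if k == n.+1 then D else B k.
transitivity (\int[P]_w ((\1_F0 w)%:E * hold_kernel (X n w) D * hold_weight n B w)).
  rewrite -indicE_integral//; last exact: measurableI.
  rewrite -setIA (_ : hold_event n B `&` _ = hold_event n.+1 BD); last first.
    apply/seteqP; split => [w [wB wD] k /= /andP[k1]|w wBD].
      rewrite leq_eqVlt /BD => /orP[/eqP ->|kn]; first by rewrite eqxx.
      by rewrite ltn_eqF//; apply: wB; rewrite /= k1.
    split=> [k /= /andP[k1 kn]|].
      have := wBD k; rewrite /= k1 /BD ltn_eqF ?ltnS//; apply.
      exact: leqW.
    by have := wBD n.+1; rewrite /= leqnn /BD eqxx; exact.
  rewrite (lbmjp_times XtauP)//; last by move=> k; rewrite /BD; case: ifP.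
  rewrite [LHS]mulindic; last exact: mF0.
  apply: eq_integral => w _.
  rewrite -/(hold_weight n.+1 BD w) hold_weightS {2}/BD eqxx -muleA; congr (_ * _).
  rewrite muleC; congr (_ * _); rewrite /hold_weight.
  apply: eq_big_nat => k /andP[_ kn]; rewrite /BD ltn_eqF//.
rewrite -hold_pull_out//; last first.
  apply: emeasurable_funM => //.
  by apply: (measurableT_comp (measurable_kernel hold_kernel D mD)); exact: measurable_chain.
rewrite [RHS]mulindic; last exact: measurableI.
by apply: eq_integral => w _; rewrite indicI /= EFinM muleAC.
Qed.

Lemma ge0_expectation_chain n (Phi : past n n.+1 * E -> \bar R) :
  (forall z, 0 <= Phi z) -> measurable_fun setT Phi ->
  \int[P]_w Phi (w, X n.+1 w) = \int[P]_w \int[Gamma (X n w)]_y Phi (w, y).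
Proof.
move=> Phi0 mPhi.
have mXn' : measurable_fun setT (X n : past n n.+1 -> E).
  exact: measurable_past_chain.
apply: (@ge0_integral_disintegration _ _ _ _ (past n n.+1) _ _ P id (X n.+1)
  (@measurable_past_id n n.+1) (mX n.+1) (kpullback Gamma mXn')) => //.
by move=> F D mF mD; exact: cond_law_chain.
Qed.

Lemma ge0_expectation_hold n (Phi : past n n * \bar R -> \bar R) :
  (forall z, 0 <= Phi z) -> measurable_fun setT Phi ->
  \int[P]_w Phi (w, tau n.+1 w) =
  \int[P]_w \int[hold_kernel (X n w)]_s Phi (w, s).
Proof.
move=> Phi0 mPhi.
have mXn' : measurable_fun setT (X n : past n n -> E).
  exact: measurable_past_chain.
apply: (@ge0_integral_disintegration _ _ _ _ (past n n) _ _ P id (tau n.+1)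
  (@measurable_past_id n n) (mtau n.+1) (kpullback hold_kernel mXn')) => //.
by move=> F D mF mD; exact: cond_law_hold.
Qed.

End conditional_laws.

(** * Jump times and the time spent in a state *)

Section jump_times.
Context {R : realType} (Omega : Type) (tau : nat -> Omega -> \bar R).
Hypothesis tau_ge0 : forall n w, 0 <= tau n w.

Local Notation T := (jump_time tau).

Lemma jump_timeS n w : T n.+1 w = T n w + tau n.+1 w.
Proof. by rewrite /jump_time big_nat_recr. Qed.

Lemma jump_time_ge0 n w : 0 <= T n w.
Proof. exact: sume_ge0. Qed.

Lemma jump_time0 w : T 0%N w = 0.
Proof. by rewrite /jump_time big_nil. Qed.

Lemma le_jump_time m n w : (m <= n)%N -> T m w <= T n w.
Proof.
move=> /subnK <-; elim: (n - m)%N => [//|k IH].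
by rewrite addSn jump_timeS (le_trans IH)// leeDl.
Qed.

(** Truncation at [u] keeps all quantities finite, whether or not the n-th jump
    occurs. *)
Definition trunc_time (u : R) n w : R := fine (mine (T n w) u%:E).

(** The time before [u] that is spent in the n-th state. *)
Definition sojourn (u : R) n w : R := (trunc_time u n.+1 w - trunc_time u n w)%R.

Section truncation.
Variables (u : R) (u0 : (0 <= u)%R).

Lemma trunc_timeE n w : (trunc_time u n w)%:E = mine (T n w) u%:E.
Proof.
rewrite /trunc_time fineK// fin_numE; apply/andP; split.
  by rewrite gt_eqF// lt_min ltNyr andbT (lt_le_trans _ (jump_time_ge0 n w)).
by rewrite lt_eqF// gt_min ltry orbT.
Qed.

Lemma trunc_time_ge0 n w : (0 <= trunc_time u n w)%R.
Proof. by rewrite -lee_fin trunc_timeE le_min jump_time_ge0 lee_fin. Qed.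

Lemma trunc_time_le n w : (trunc_time u n w <= u)%R.
Proof. by rewrite -lee_fin trunc_timeE ge_min lexx orbT. Qed.

Lemma le_trunc_time m n w : (m <= n)%N -> (trunc_time u m w <= trunc_time u n w)%R.
Proof.
move=> mn; rewrite -lee_fin !trunc_timeE le_min !ge_min.
by rewrite le_jump_time// lexx orbT.
Qed.

Lemma sojourn_ge0 n w : (0 <= sojourn u n w)%R.
Proof. by rewrite subr_ge0 le_trunc_time. Qed.

Lemma sojourn_le n w : (sojourn u n w <= u)%R.
Proof.
by rewrite lerBlDr (le_trans (trunc_time_le _ _))// lerDl trunc_time_ge0.
Qed.

Lemma jump_time_leS n w : (T n.+1 w <= u%:E) =
  (T n w <= u%:E) && (tau n.+1 w <= (u - trunc_time u n w)%:E).
Proof.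
rewrite jump_timeS; have [Tu|uT] := leP (T n w) u%:E; last first.
  by apply/negbTE; rewrite -ltNge (lt_le_trans uT)// leeDl.
have Tfin : T n w \is a fin_num.
  by rewrite ge0_fin_numE ?jump_time_ge0// (le_lt_trans Tu)// ltry.
by rewrite EFinB trunc_timeE min_l// leeBrDl.
Qed.

(** The sojourn is the holding time, capped by what remains of the horizon after
    the n-th jump. This exhibits it as a function of tau_(n+1) and of the past. *)
Lemma sojournE n w :
  (sojourn u n w)%:E = maxe 0 (mine (tau n.+1 w) (u - trunc_time u n w)%:E).
Proof.
rewrite /sojourn EFinB EFinB !trunc_timeE jump_timeS.
have [Tu|uT] := leP (T n w) u%:E; last first.
  have u1 : u%:E <= T n w + tau n.+1 w by rewrite (le_trans (ltW uT))// leeDl.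
  by rewrite min_r// subee// min_r// maxxx.
have Tfin : T n w \is a fin_num.
  by rewrite ge0_fin_numE ?jump_time_ge0// (le_lt_trans Tu)// ltry.
rewrite max_r//; last by rewrite le_min tau_ge0 leeBrDl// adde0.
have [Tu'|uT'] := leP (T n w + tau n.+1 w) u%:E.
  rewrite addeAC subee// add0e min_l//.
  by rewrite leeBrDl.
rewrite min_r// leeBlDl//; exact: ltW.
Qed.

End truncation.
End jump_times.

Section jump_times_measurable.
Context {R : realType} d (Omega : measurableType d) (tau : nat -> Omega -> \bar R).

Lemma measurable_jump_time n : (forall k, (1 <= k <= n)%N -> measurable_fun setT (tau k)) ->
  measurable_fun setT (jump_time tau n).
Proof.
elim: n => [|n IH] mtau.
  rewrite (_ : jump_time tau 0 = cst 0)//; apply/funext => w; exact: jump_time0.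
rewrite (_ : jump_time tau n.+1 = jump_time tau n \+ tau n.+1); last first.
  by apply/funext => w; rewrite jump_timeS.
apply: emeasurable_funD; last by apply: mtau; rewrite /= leqnn.
by apply: IH => k /andP[k1 kn]; apply: mtau; rewrite k1 leqW.
Qed.

Lemma measurable_trunc_time u n :
  (forall k, (1 <= k <= n)%N -> measurable_fun setT (tau k)) ->
  measurable_fun setT (trunc_time tau u n).
Proof.
move=> mtau; apply: (measurableT_comp (fine_measurable _)) => //.
apply: measurable_mine => //; exact: measurable_jump_time.
Qed.

Lemma measurable_sojourn u n :
  (forall k, (1 <= k <= n.+1)%N -> measurable_fun setT (tau k)) ->
  measurable_fun setT (sojourn tau u n).
Proof.
move=> mtau; apply: measurable_funB; apply: measurable_trunc_time => //.
by move=> k /andP[k1 kn]; apply: mtau; rewrite k1 leqW.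
Qed.

Lemma measurable_jumped u n :
  (forall k, (1 <= k <= n)%N -> measurable_fun setT (tau k)) ->
  measurable [set w | jump_time tau n w <= u%:E].
Proof.
move=> mtau; rewrite -[X in measurable X]setTI.
by apply: (@measurable_lee _ _ _ setT measurableT (jump_time tau n) (cst u%:E)) => //;
  exact: measurable_jump_time.
Qed.

End jump_times_measurable.

(** * One jump and its compensator *)

Section increments.
Context {R : realType} d (E : measurableType d) d' (Omega : measurableType d').
Variables (gamma : R.-pker E ~> E) (t : E * E -> R) (g : R -> R).
Hypotheses (mgt : measurable_fun setT (g \o t)) (gt_ge0 : forall z, (0 <= g (t z))%R).
Variables (X : nat -> Omega -> E) (tau : nat -> Omega -> \bar R).
Hypothesis mX : forall n, measurable_fun setT (X n).
Hypothesis mtau : forall n, measurable_fun setT (tau n).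
Hypothesis tau_ge0 : forall n w, 0 <= tau n w.
Variables (x0 : E) (P : probability Omega R).
Hypothesis XtauP : is_lbmjp gamma t g X tau x0 P.

Local Notation rate := (jump_rate gamma t g).
Local Notation Gamma := (jump_kernel gamma mgt gt_ge0).
Local Notation past n m := (g_sigma_algebraType (past_system X tau n m)).

Definition jumped (u : R) n : set Omega := [set w | jump_time tau n.+1 w <= u%:E].

Definition finite_rate n : set Omega := [set w | rate (X n w) < +oo].

Let mjumped u n : measurable (jumped u n).
Proof. exact: measurable_jumped. Qed.

Let mrateX n m : measurable_fun setT ((rate \o X n) : past n m -> \bar R).
Proof.
apply: measurableT_comp; first exact: measurable_jump_rate.
exact: measurable_past_chain.
Qed.

Lemma measurable_finite_rate n m : measurable (finite_rate n : set (past n m)).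
Proof.
rewrite -[X in measurable X]setTI.
exact: (@measurable_lte _ _ _ setT measurableT
  (rate \o X n : past n m -> \bar R) (cst +oo)).
Qed.

Section compensator.
Variables (u : R) (n : nat).

(* What remains of the horizon after the n-th jump; it is known before
   tau_(n+1). *)
Let slack w := (u - trunc_time tau u n w)%R.

Let slack_ge0 w : (0 <= slack w)%R.
Proof. by rewrite subr_ge0; exact: trunc_time_le. Qed.

Let mslack : measurable_fun setT (slack : past n n -> R).
Proof.
apply: measurable_funB => //; apply: measurable_trunc_time => k kn.
exact: measurable_past_hold.
Qed.

Let mcap : measurable_fun setT
  (fun z : past n n * \bar R => maxe 0 (mine z.2 (slack z.1)%:E)).
Proof.
apply: measurable_maxe => //; apply: measurable_mine => //.
by apply/measurable_EFinP; exact: measurableT_comp mslack measurable_fst.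
Qed.

Let cap_ge0 (s : \bar R) (v : R) : 0 <= maxe 0 (mine s v%:E).
Proof. by rewrite le_max lexx. Qed.

(** The sojourn, multiplied by the rate, compensates the indicator of the jump:
    given the past, [exp_law_trunc_mean] applies with the remaining horizon as
    truncation level. At rate +oo the left-hand side is zero, since no time is
    spent, although the jump occurs; whence the restriction to finite rates on the
    right. *)
Lemma expected_sojourn (phi : Omega -> \bar R) :
  (forall w, 0 <= phi w) -> measurable_fun setT (phi : past n n -> \bar R) ->
  \int[P]_w (phi w * (fine (rate (X n w)) * sojourn tau u n w)%:E) =
  \int[P]_w (phi w * (\1_(finite_rate n) w * \1_(jumped u n) w)%:E).
Proof.
move=> phi0 mphi.
pose r w := fine (rate (X n w)).
have r0 w : (0 <= r w)%R by rewrite fine_ge0// jump_rate_ge0.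
have mr : measurable_fun setT (r : past n n -> R).
  by apply: (@measurableT_comp _ _ _ _ _ _ fine _ (rate \o X n : past n n -> \bar R)).
have mphi1 : measurable_fun setT (fun z : past n n * \bar R => phi z.1).
  exact: measurableT_comp mphi measurable_fst.
pose Phi1 (z : past n n * \bar R) :=
  phi z.1 * ((r z.1)%:E * maxe 0 (mine z.2 (slack z.1)%:E)).
have Phi1_ge0 z : 0 <= Phi1 z by rewrite !mule_ge0// lee_fin.
have mPhi1 : measurable_fun setT Phi1.
  apply: emeasurable_funM => //; apply: emeasurable_funM => //.
  by apply/measurable_EFinP; exact: measurableT_comp mr measurable_fst.
have mfinite : measurable (finite_rate n : set (past n n)).
  exact: measurable_finite_rate.
pose quick : set (past n n * \bar R) :=
  [set z | jump_time tau n z.1 <= u%:E] `&` [set z | z.2 <= (slack z.1)%:E].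
have mquick : measurable quick.
  apply: measurableI.
    rewrite -[X in measurable X]setTI.
    apply: (@measurable_lee _ _ _ setT measurableT
      (fun z : past n n * \bar R => jump_time tau n z.1) (cst u%:E)) => //.
    apply: (@measurableT_comp _ _ _ _ _ _ (jump_time tau n : past n n -> \bar R)) => //.
    by apply: measurable_jump_time => k kn; exact: measurable_past_hold.
  rewrite -[X in measurable X]setTI.
  apply: (@measurable_lee _ _ _ setT measurableT snd
    (fun z : past n n * \bar R => (slack z.1)%:E)) => //.
  by apply/measurable_EFinP; exact: measurableT_comp mslack measurable_fst.
pose Phi2 (z : past n n * \bar R) :=
  phi z.1 * (\1_(finite_rate n : set (past n n)) z.1 * \1_quick z)%:E.
have Phi2_ge0 z : 0 <= Phi2 z by rewrite mule_ge0// lee_fin mulr_ge0.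
have mPhi2 : measurable_fun setT Phi2.
  apply: emeasurable_funM => //; apply/measurable_EFinP; apply: measurable_funM.
    by apply: measurableT_comp => //; exact: measurable_indic.
  exact: measurable_indic.
transitivity (\int[P]_w Phi1 (w, tau n.+1 w)).
  by apply: eq_integral => w _; rewrite EFinM sojournE.
transitivity (\int[P]_w Phi2 (w, tau n.+1 w)); last first.
  apply: eq_integral => w _; rewrite /Phi2 /=; congr (_ * (_ * _)%:E).
  rewrite !indicE; congr ((nat_of_bool _)%:R); apply/idP/idP; rewrite !inE /jumped /quick /=.
    by rewrite jump_time_leS// => -[-> ->].
  by rewrite jump_time_leS// => /andP[].
rewrite (ge0_expectation_hold mgt gt_ge0 mX mtau XtauP Phi1_ge0 mPhi1).
rewrite (ge0_expectation_hold mgt gt_ge0 mX mtau XtauP Phi2_ge0 mPhi2).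
apply: eq_integral => w _.
have mcapw : measurable_fun setT (fun s : \bar R => maxe 0 (mine s (slack w)%:E)).
  by apply: measurable_maxe => //; exact: measurable_mine.
pose K : {measure set (\bar R) -> \bar R} := hold_kernel gamma mgt gt_ge0 (X n w).
pose reached := (\1_[set v | (jump_time tau n v <= u%:E)%E] w : R).
have -> : \int[K]_s Phi1 (w, s) =
    phi w * ((r w)%:E * \int[K]_s maxe 0 (mine s (slack w)%:E)).
  transitivity (\int[K]_s (phi w * ((r w)%:E * maxe 0 (mine s (slack w)%:E)))) => //.
  rewrite ge0_integralZl//.
  - by rewrite ge0_integralZl// lee_fin.
  - exact: emeasurable_funM.
  - by move=> s _; rewrite mule_ge0// lee_fin.
have -> : \int[K]_s Phi2 (w, s) =
    phi w * ((\1_(finite_rate n) w * reached)%:E * K [set s | s <= (slack w)%:E]).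
  have mle : measurable [set s : \bar R | s <= (slack w)%:E].
    rewrite -[X in measurable X]setTI.
    exact: (@measurable_lee _ _ _ setT measurableT id (cst (slack w)%:E)).
  transitivity (\int[K]_s (phi w * ((\1_(finite_rate n) w * reached)%:E *
      (\1_[set s : \bar R | (s <= (slack w)%:E)%E] s)%:E))).
    apply: eq_integral => s _; rewrite /Phi2 /= -EFinM -mulrA; congr (_ * (_ * _)%:E).
    rewrite /quick indicI /= /reached !indicE.
    by congr ((nat_of_bool _)%:R * (nat_of_bool _)%:R)%R; apply/idP/idP; rewrite !inE.
  rewrite ge0_integralZl//; last 2 first.
  - apply: emeasurable_funM => //; apply/measurable_EFinP; exact: measurable_indic.
  - by move=> s _; rewrite -EFinM lee_fin !mulr_ge0.
  rewrite ge0_integralZl//; last 2 first.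
  - apply/measurable_EFinP; exact: measurable_indic.
  - by rewrite lee_fin mulr_ge0.
  by rewrite (integral_indic _ measurableT mle) setIT.
congr (_ * _); rewrite /finite_rate indicE.
have [roo|] := ltP (rate (X n w)) +oo; last first.
  rewrite leye_eq => /eqP roo; rewrite memNset ?mul0r ?mul0e; last first.
    by rewrite /= roo ltxx.
  have := exp_law_trunc_meany (jump_rate_ge0 gamma gt_ge0 (X n w)) (slack_ge0 w) roo.
  by rewrite /K /hold_kernel /kexp => ->; rewrite mule0.
rewrite mem_set// mul1r /reached indicE.
have [Tu|uT] := leP (jump_time tau n w) u%:E.
  rewrite mem_set// mul1e.
  have := exp_law_trunc_mean (jump_rate_ge0 gamma gt_ge0 (X n w)) (slack_ge0 w).
  by apply; rewrite lt_eqF.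
rewrite memNset ?mul0e; last by apply/negP; rewrite -ltNge.
(* When the n-th jump comes after the horizon, nothing remains of it and the
   truncated holding time vanishes. *)
have -> : slack w = 0%R.
  apply/eqP; rewrite /slack subr_eq0 -eqe eq_sym trunc_timeE// min_r//.
  exact: ltW.
rewrite integral0_eq ?mule0// => s _.
by apply/eqP; rewrite eq_le cap_ge0 ge_max lexx ge_min lexx orbT.
Qed.

(** An exponential time of infinite rate is zero. *)
Lemma infinite_rate_sojourn :
  {ae P, forall w, rate (X n w) = +oo -> sojourn tau u n w = 0%R}.
Proof.
pose F : set Omega := ~` finite_rate n.
pose D : set (\bar R) := ~` [set 0].
have mD : measurable D by apply: measurableC; exact: emeasurable_set1.
have sF : <<s past_system X tau n n >> F.
  rewrite /F; apply: (@measurableC _ (past n n)); exact: measurable_finite_rate.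
have mtD : measurable (tau n.+1 @^-1` D).
  by rewrite -[X in measurable X]setTI; exact: mtau.
exists (F `&` tau n.+1 @^-1` D); split.
- by apply: measurableI => //; exact: past_measurable sF.
- rewrite (cond_law_hold mgt gt_ge0 mX mtau XtauP mD sF) integral0_eq// => w.
  rewrite /F /finite_rate /= => /negP; rewrite -leNgt leye_eq => /eqP roo.
  rewrite /hold_kernel /kexp /= /exp_law roo /= diracE memNset//.
  by apply.
- move=> w /= /not_implyP[roo sw]; split.
    by rewrite /F /finite_rate /= roo ltxx.
  move=> tau0; apply: sw; apply/EFin_inj.
  by rewrite sojournE// tau0 min_l ?maxxx// lee_fin; exact: slack_ge0.
Qed.

End compensator.

Section bounded_increment.
Variables (f : E -> R) (c : R).
Hypotheses (mf : measurable_fun setT f) (fc : forall y, (0 <= f y <= c)%R).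

(** What the n-th state contributes to f(Y_u) - f(X_0) - int_0^u Lf(Y_r) dr. *)
Definition increment (u : R) n w : R :=
  (\1_(jumped u n) w * (f (X n.+1 w) - f (X n w)) -
   generator gamma t g f (X n w) * sojourn tau u n w)%R.

Let c0 : (0 <= c)%R.
Proof. by have /andP[+] := fc point; exact: le_trans. Qed.

Let f0 y : (0 <= f y)%R. Proof. by case/andP: (fc y). Qed.

Let mean x : R := fine (\int[Gamma x]_y (f y)%:E).

Let meanE x : (mean x)%:E = \int[Gamma x]_y (f y)%:E.
Proof.
rewrite /mean fineK// ge0_fin_numE; last first.
  by apply: integral_ge0 => y _; rewrite lee_fin.
apply: (@le_lt_trans _ _ c%:E); last exact: ltry.
have <- : \int[Gamma x]_y c%:E = c%:E.
  by rewrite integral_cst// prob_kernel mule1.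
apply: ge0_le_integral => //.
- by move=> y _; rewrite lee_fin.
- exact/measurable_EFinP.
- by move=> y _; rewrite lee_fin; case/andP: (fc y).
Qed.

Let mean0 x : (0 <= mean x)%R.
Proof. by apply: fine_ge0; apply: integral_ge0 => y _; rewrite lee_fin. Qed.

Let mean_le x : (mean x <= c)%R.
Proof.
rewrite -lee_fin meanE.
have <- : \int[Gamma x]_y c%:E = c%:E.
  by rewrite integral_cst// prob_kernel mule1.
apply: ge0_le_integral => //.
- by move=> y _; rewrite lee_fin.
- exact/measurable_EFinP.
- by move=> y _; rewrite lee_fin; case/andP: (fc y).
Qed.

Let mmean : measurable_fun setT mean.
Proof.
apply: (measurableT_comp (fine_measurable _)) => //.
apply: measurable_fun_integral_kernel => //.
- exact: measurable_kernel.
- exact/measurable_EFinP.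
Qed.

Section fixed_step.
Variables (u : R) (n : nat).

Let r w := fine (rate (X n w)).

(** The generator is expanded by [generatorE]. States of infinite rate make no
    difference, because almost surely no time is spent there. The increment becomes
    a difference of two nonnegative functions, whose means can be compared before
    they are known to be finite. *)
Let increment_ae : {ae P, forall w, increment u n w =
  (\1_(jumped u n) w * f (X n.+1 w) + r w * f (X n w) * sojourn tau u n w -
   (\1_(jumped u n) w * f (X n w) + r w * mean (X n w) * sojourn tau u n w))%R}.
Proof.
have := infinite_rate_sojourn u n; apply: filterS => w roo; rewrite /increment.
have [rw|] := ltP (rate (X n w)) +oo; last first.
  rewrite leye_eq => /eqP/roo ->; rewrite !mulr0; ring.
rewrite (generatorE mgt gt_ge0 mf fc rw) -/(mean _) -/(r w); ring.
Qed.

Let r0 w : (0 <= r w)%R.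
Proof. by rewrite fine_ge0// jump_rate_ge0. Qed.

Let mr : measurable_fun setT r.
Proof.
apply: (measurableT_comp (fine_measurable measurableT)).
exact: measurableT_comp (measurable_jump_rate gamma mgt gt_ge0) (mX n).
Qed.

Let mfin : measurable (finite_rate n).
Proof.
apply: (@past_measurable _ _ _ _ _ X tau mX mtau n n).
exact: measurable_finite_rate.
Qed.

Let mS : measurable_fun setT (sojourn tau u n).
Proof. exact: measurable_sojourn. Qed.

Let gain_next w := (\1_(jumped u n) w * f (X n.+1 w))%R.
Let gain_here w := (\1_(jumped u n) w * f (X n w))%R.
Let flow_next w := (r w * mean (X n w) * sojourn tau u n w)%R.
Let flow_here w := (r w * f (X n w) * sojourn tau u n w)%R.

Let mgain_next : measurable_fun setT gain_next.
Proof.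
apply: measurable_funM; first exact: measurable_indic.
exact: measurableT_comp mf (mX n.+1).
Qed.

Let mgain_here : measurable_fun setT gain_here.
Proof.
apply: measurable_funM; first exact: measurable_indic.
exact: measurableT_comp mf (mX n).
Qed.

Let mflow_next : measurable_fun setT flow_next.
Proof.
do 2 apply: measurable_funM => //; exact: measurableT_comp mmean (mX n).
Qed.

Let mflow_here : measurable_fun setT flow_here.
Proof.
do 2 apply: measurable_funM => //; exact: measurableT_comp mf (mX n).
Qed.

Let gain_next_ge0 w : (0 <= gain_next w)%R. Proof. exact: mulr_ge0. Qed.
Let gain_here_ge0 w : (0 <= gain_here w)%R. Proof. exact: mulr_ge0. Qed.
Let flow_next_ge0 w : (0 <= flow_next w)%R.
Proof. by rewrite !mulr_ge0// sojourn_ge0. Qed.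
Let flow_here_ge0 w : (0 <= flow_here w)%R.
Proof. by rewrite !mulr_ge0// sojourn_ge0. Qed.

Let integral_indicM (A : set Omega) (h : Omega -> R) : measurable A ->
  \int[P]_(w in A) (h w)%:E = \int[P]_w (\1_A w * h w)%:E.
Proof.
move=> mA; rewrite integral_mkcond; apply: eq_integral => w _.
by rewrite patchE indicE; case: ifPn => _; rewrite ?mul1r ?mul0r.
Qed.

(** [expected_sojourn], with [h (X n)] and the event [A] as known factors. *)
Let expected_flow (A : set Omega) (h : E -> R) :
  <<s past_system X tau n n >> A -> measurable_fun setT h -> (forall y, 0 <= h y)%R ->
  \int[P]_(w in A) (r w * h (X n w) * sojourn tau u n w)%:E =
  \int[P]_(w in A) (\1_(jumped u n) w * h (X n w) * \1_(finite_rate n) w)%:E.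
Proof.
move=> sA mh h0; have mA := past_measurable mX mtau sA.
have := @expected_sojourn u n (fun w => (\1_A w * h (X n w))%:E).
rewrite [in X in _ -> X = _]integral_indicM// [in X in _ -> _ = X]integral_indicM// => H.
transitivity (\int[P]_w ((\1_A w * h (X n w))%:E * (r w * sojourn tau u n w)%:E)).
  by apply: eq_integral => w _; rewrite -EFinM; congr EFin; ring.
rewrite H//.
- apply: eq_integral => w _; rewrite -EFinM; congr EFin; ring.
- by move=> w; rewrite lee_fin mulr_ge0.
- apply/measurable_EFinP; apply: measurable_funM.
    exact: (@measurable_indic _ (past n n)).
  apply: (@measurableT_comp _ _ _ _ _ _ h _ (X n : past n n -> E)) => //.
  exact: measurable_past_chain.
Qed.

(** Whether the jump occurs is known once tau_(n+1) is, so only X_(n+1) is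
    integrated out. *)
Let expected_gain (A : set Omega) : <<s past_system X tau n n >> A ->
  \int[P]_(w in A) (gain_next w)%:E =
  \int[P]_(w in A) (\1_(jumped u n) w * mean (X n w))%:E.
Proof.
move=> sA; have mA := past_measurable mX mtau sA.
have sA' : <<s past_system X tau n n.+1 >> A by exact: past_systemW sA.
rewrite [LHS]integral_indicM// [RHS]integral_indicM//.
pose AJ : set (past n n.+1) := A `&` jumped u n.
have mAJ : measurable AJ.
  apply: measurableI => //; apply: (@measurable_jumped _ _ (past n n.+1)).
  by move=> k kn; exact: measurable_past_hold.
pose Phi (z : past n n.+1 * E) := ((\1_AJ z.1 * f z.2)%:E : \bar R).
transitivity (\int[P]_w Phi (w, X n.+1 w)).
  by apply: eq_integral => w _; rewrite /Phi /AJ /= indicI /= mulrA.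
rewrite (ge0_expectation_chain mgt gt_ge0 mX mtau XtauP).
- apply: eq_integral => w _; rewrite /Phi /= mulrA.
  under eq_integral do rewrite EFinM.
  rewrite ge0_integralZl//.
  + by rewrite -meanE -EFinM /AJ indicI.
  + exact/measurable_EFinP.
  + by move=> y _; rewrite lee_fin.
- by move=> z; rewrite lee_fin mulr_ge0.
- apply/measurable_EFinP; apply: measurable_funM; last exact: measurableT_comp.
  by apply: measurableT_comp => //; exact: measurable_indic.
Qed.

(** At finite rates [gain_next] has the mean of [flow_next], and [flow_here] that
    of [gain_here]. Infinite rates add nothing to the flows, and there the gains
    agree because the embedded kernel is a Dirac mass. *)
Let balance (A : set Omega) : <<s past_system X tau n n >> A ->
  \int[P]_(w in A) (gain_next w)%:E + \int[P]_(w in A) (flow_here w)%:E =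
  \int[P]_(w in A) (gain_here w)%:E + \int[P]_(w in A) (flow_next w)%:E.
Proof.
move=> sA; have mA := past_measurable mX mtau sA.
rewrite expected_gain// /flow_here /flow_next !expected_flow//.
have mJ : measurable_fun setT (\1_(jumped u n) : Omega -> R) by exact: measurable_indic.
have mF : measurable_fun setT (\1_(finite_rate n) : Omega -> R) by exact: measurable_indic.
have mhX (h : E -> R) : measurable_fun setT h -> measurable_fun setT (h \o X n).
  by move=> mh; exact: measurableT_comp mh (mX n).
have mJh (h : E -> R) : measurable_fun setT h ->
    measurable_fun A (fun w => (\1_(jumped u n) w * h (X n w))%:E).
  move=> mh; apply/measurable_funTS/measurable_EFinP.
  by apply: measurable_funM => //; exact: mhX.
have mJhF (h : E -> R) : measurable_fun setT h ->
    measurable_fun A (fun w => (\1_(jumped u n) w * h (X n w) * \1_(finite_rate n) w)%:E).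
  move=> mh; apply/measurable_funTS/measurable_EFinP.
  by do 2 apply: measurable_funM => //; exact: mhX.
have Jh0 (h : E -> R) w : (forall y, 0 <= h y)%R ->
    0 <= (\1_(jumped u n) w * h (X n w))%:E.
  by move=> h0; rewrite lee_fin mulr_ge0.
have JhF0 (h : E -> R) w : (forall y, 0 <= h y)%R ->
    0 <= (\1_(jumped u n) w * h (X n w) * \1_(finite_rate n) w)%:E.
  by move=> h0; rewrite lee_fin !mulr_ge0.
rewrite -(ge0_integralD _ mA (fun w _ => Jh0 mean w mean0) (mJh _ mmean)
  (fun w _ => JhF0 f w f0) (mJhF _ mf)).
rewrite -(ge0_integralD _ mA (fun w _ => Jh0 f w f0) (mJh _ mf)
  (fun w _ => JhF0 mean w mean0) (mJhF _ mmean)).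
apply: eq_integral => w _; rewrite /gain_here -!EFinD; congr EFin.
rewrite !indicE; have [|fin] := boolP (w \in finite_rate n).
  by rewrite !mulr1 addrC.
rewrite !mulr0 !addr0; congr (_ * _)%R.
rewrite /mean integral_jump_kernel_degenerate//; first exact/measurable_EFinP.
move: fin; rewrite notin_setE /finite_rate /= => /negP/negbTE ->.
by rewrite andbF.
Qed.

Let int_jumped_le : \int[P]_w (c * \1_(jumped u n) w)%:E < +oo.
Proof.
under eq_integral do rewrite EFinM.
rewrite ge0_integralZl//; last exact/measurable_EFinP/measurable_indic.
rewrite integral_indic// setIT.
rewrite (@le_lt_trans _ _ c%:E)//; last exact: ltry.
by rewrite -[leRHS]mule1 lee_wpmul2l ?lee_fin// probability_le1.
Qed.

Let gain_integrable (h : Omega -> R) : measurable_fun setT h ->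
  (forall w, 0 <= h w <= c * \1_(jumped u n) w)%R ->
  P.-integrable setT (EFin \o h).
Proof.
move=> mh hc; apply/integrableP; split; first exact/measurable_EFinP.
apply: le_lt_trans int_jumped_le; apply: ge0_le_integral => //.
- by apply/measurableT_comp/measurable_EFinP.
- apply/measurable_EFinP; apply: measurable_funM => //; exact: measurable_indic.
- move=> w _; have /andP[h0 hle] := hc w.
  by rewrite /= lee_fin ger0_norm.
Qed.

Let gain_next_integrable : P.-integrable setT (EFin \o gain_next).
Proof.
apply: gain_integrable => // w; rewrite gain_next_ge0 /gain_next mulrC.
by rewrite ler_wpM2r//; case/andP: (fc (X n.+1 w)).
Qed.

Let gain_here_integrable : P.-integrable setT (EFin \o gain_here).
Proof.
apply: gain_integrable => // w; rewrite gain_here_ge0 /gain_here mulrC.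
by rewrite ler_wpM2r//; case/andP: (fc (X n w)).
Qed.

Let flow_integrable (h : E -> R) : measurable_fun setT h ->
  (forall y, 0 <= h y <= c)%R ->
  P.-integrable setT (fun w => (r w * h (X n w) * sojourn tau u n w)%:E).
Proof.
move=> mh hc; have h0 y : (0 <= h y)%R by case/andP: (hc y).
have mhX : measurable_fun setT (h \o X n) by exact: measurableT_comp mh (mX n).
apply/integrableP; split.
  by apply/measurable_EFinP; do 2 apply: measurable_funM => //.
rewrite (_ : integral _ _ _ = \int[P]_w (r w * h (X n w) * sojourn tau u n w)%:E).
  rewrite expected_flow//; last exact: (@measurableT _ (past n n)).
  apply: le_lt_trans int_jumped_le; apply: ge0_le_integral => //.
  - by move=> w _; rewrite lee_fin !mulr_ge0.
  - apply/measurable_EFinP; apply: measurable_funM; last exact: measurable_indic.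
    by apply: measurable_funM => //; exact: measurable_indic.
  - by apply/measurable_EFinP; apply: measurable_funM => //; exact: measurable_indic.
  - move=> w _; have /andP[_ hle] := hc (X n w); rewrite lee_fin.
    apply: (@le_trans _ _ (\1_(jumped u n) w * h (X n w))%R).
      by rewrite ler_piMr ?mulr_ge0// indicE lern1 leq_b1.
    by rewrite mulrC ler_wpM2r.
by apply: eq_integral => w _; rewrite gee0_abs// lee_fin !mulr_ge0// sojourn_ge0.
Qed.

Let flow_next_integrable : P.-integrable setT (EFin \o flow_next).
Proof. by apply: flow_integrable => // y; rewrite mean0 mean_le. Qed.

Let flow_here_integrable : P.-integrable setT (EFin \o flow_here).
Proof. exact: flow_integrable. Qed.

Lemma measurable_increment : measurable_fun setT (increment u n).
Proof.
apply: measurable_funB; apply: measurable_funM => //.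
- by apply: measurable_funB; apply: measurableT_comp mf _.
- exact: measurableT_comp (measurable_generator gamma mgt mf) (mX n).
Qed.

Let increment_aeE : ae_eq P setT (EFin \o increment u n)
  (fun w => ((EFin \o gain_next) \+ (EFin \o flow_here)) w -
            ((EFin \o gain_here) \+ (EFin \o flow_next)) w).
Proof. by have := increment_ae; apply: filterS => w /= -> _. Qed.

(** [balance], after checking that the four terms are integrable. *)
Lemma expected_increment (A : set Omega) : <<s past_system X tau n n >> A ->
  \int[P]_(w in A) (increment u n w)%:E = 0.
Proof.
move=> sA; have mA := past_measurable mX mtau sA.
have onA h : P.-integrable setT h -> P.-integrable A h.
  exact: integrableS.
have [ign ifh] := (onA _ gain_next_integrable, onA _ flow_here_integrable).
have [igh ifn] := (onA _ gain_here_integrable, onA _ flow_next_integrable).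
have finA h : P.-integrable A h -> \int[P]_(w in A) h w \is a fin_num.
  exact: integrable_fin_num.
transitivity (\int[P]_(w in A) (((EFin \o gain_next) \+ (EFin \o flow_here)) w -
    ((EFin \o gain_here) \+ (EFin \o flow_next)) w)).
  apply: ae_eq_integral => //.
  - by apply/measurable_funTS/measurable_EFinP; exact: measurable_increment.
  - exact: (measurable_int P (integrableB mA (integrableD mA ign ifh) (integrableD mA igh ifn))).
  - by have := increment_aeE; apply: filterS => w H _; exact: H.
rewrite integralB//; try exact: integrableD.
rewrite !integralD//= balance// subee// fin_numD.
by rewrite !finA.
Qed.

(** Both [f] and its mean under the embedded kernel lie between 0 and [c]. *)
Lemma increment_bound : {ae P, forall w, (`|increment u n w| <=
  c * (\1_(jumped u n) w + r w * sojourn tau u n w))%R}.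
Proof.
have := increment_ae; apply: filterS => w ->.
have /andP[f1 fc1] := fc (X n w); have /andP[f2 fc2] := fc (X n.+1 w).
have m1 := mean0 (X n w); have m2 := mean_le (X n w).
have S0 := sojourn_ge0 tau_ge0 u n w.
have rS0 : (0 <= r w * sojourn tau u n w)%R by rewrite mulr_ge0.
have J0 : (0 <= \1_(jumped u n) w :> R)%R by [].
rewrite ler_norml; apply/andP; split; nra.
Qed.

(** The two terms have the same mean, up to states of infinite rate. *)
Lemma expected_increment_bound :
  \int[P]_w (\1_(jumped u n) w + r w * sojourn tau u n w)%:E <= 2%:E * P (jumped u n).
Proof.
under eq_integral do rewrite EFinD.
have mJ : measurable_fun setT (fun w => (\1_(jumped u n) w)%:E : \bar R).
  by apply/measurable_EFinP; exact: measurable_indic.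
have mrS : measurable_fun setT (fun w => (r w * sojourn tau u n w)%:E).
  by apply/measurable_EFinP; exact: measurable_funM.
rewrite ge0_integralD//; last first.
  by move=> w _; rewrite lee_fin mulr_ge0// sojourn_ge0.
rewrite (integral_indic P measurableT (mjumped u n)) setIT.
rewrite (_ : 2%:E = 1 + 1) ?ge0_muleDl// mul1e leeD2l//.
under eq_integral do rewrite -[r _]mulr1.
rewrite (@expected_flow setT (cst 1%R))//; last exact: (@measurableT _ (past n n)).
rewrite -[X in _ <= P X]setIT -(integral_indic P measurableT (mjumped u n)).
apply: ge0_le_integral => //.
- by move=> w _; rewrite lee_fin !mulr_ge0.
- apply/measurable_EFinP; apply: measurable_funM; last exact: measurable_indic.
  by apply: measurable_funM => //; exact: measurable_indic.
- by move=> w _; rewrite lee_fin mulr1 ler_piMr// indicE lern1 leq_b1.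
Qed.

Lemma increment_integrable : P.-integrable setT (EFin \o increment u n).
Proof.
have minc : measurable_fun setT (EFin \o increment u n).
  by apply/measurable_EFinP; exact: measurable_increment.
pose G w := ((EFin \o gain_next) \+ (EFin \o flow_here)) w -
    ((EFin \o gain_here) \+ (EFin \o flow_next)) w.
have iG : P.-integrable setT G by apply: integrableB => //; exact: integrableD.
apply/integrableP; split => //.
have /integrableP[mG] := iG; apply: le_lt_trans.
rewrite le_eqVlt; apply/orP; left; apply/eqP; apply: ge0_ae_eq_integral => //.
- exact: measurableT_comp.
- exact: measurableT_comp.
- by have := increment_aeE; apply: filterS => w H _; congr (`| _ |); exact: H.
Qed.

End fixed_step.
End bounded_increment.
End increments.

(** * Paths of the jump process *)

Section paths.
Context {R : realType} d (E : measurableType d) (Omega : Type).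
Variables (X : nat -> Omega -> E) (tau : nat -> Omega -> \bar R).
Hypothesis tau_ge0 : forall n w, 0 <= tau n w.

Local Notation T := (jump_time tau).
Local Notation Y := (jump_process X tau).

Lemma jump_time_supremum s w n : T n w <= s%:E -> s%:E < T n.+1 w ->
  supremum 0%N [set k | T k w <= s%:E] = n.
Proof.
move=> Tn Tn1.
have sup_n : supremums [set k | T k w <= s%:E] n.
  split=> [k /= Tk|k /(_ n Tn)//]; rewrite leEnat leqNgt; apply/negP => nk.
  by move: Tk; rewrite leNgt (lt_le_trans Tn1)// le_jump_time.
rewrite /supremum; case: ifPn => [/eqP/seteqP[/(_ n Tn)]//|_].
apply: (@is_subset1_supremums _ _ [set k | T k w <= s%:E]) => //.
by case: xgetP => [k -> //|/(_ n)].
Qed.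

Lemma jump_process_lt s w N : s%:E < T N w ->
  Y s w = Some (X (supremum 0%N [set k | T k w <= s%:E]) w).
Proof.
move=> sN; rewrite /jump_process ifT//.
by apply/ereal_sup_gtP; exists (T N w) => //; exists N.
Qed.

Lemma jump_processE s w n : T n w <= s%:E -> s%:E < T n.+1 w -> Y s w = Some (X n w).
Proof. by move=> Tn Tn1; rewrite (jump_process_lt Tn1) (jump_time_supremum Tn Tn1). Qed.

Lemma jump_process_None s w : (forall n, T n w <= s%:E) -> Y s w = None.
Proof.
move=> Ts; rewrite /jump_process ifF//; apply/negbTE; rewrite -leNgt.
by apply: ge_ereal_sup => _ [n _ <-].
Qed.

Lemma current_jump s w N : (0 <= s)%R -> s%:E < T N w ->
  exists2 n, (n < N)%N & T n w <= s%:E < T n.+1 w.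
Proof.
move=> s0; elim: N => [|N IH] sN.
  by move: sN; rewrite jump_time0 lte_fin ltNge s0.
have [sN'|Ns] := ltP s%:E (T N w).
  by have [n nN ?] := IH sN'; exists n => //; exact: leqW.
by exists N => //; rewrite Ns.
Qed.

(** Between two jumps, the path is constant until the next one. After explosion it
    remains in the graveyard. *)
Lemma jump_process_right s w : (0 <= s)%R ->
  exists2 e : R, (0 < e)%R & forall r, (s <= r < s + e)%R -> Y r w = Y s w.
Proof.
move=> s0; have [[N sN]|expl] := pselect (exists N, s%:E < T N w).
  have [n _ /andP[Tn Tn1]] := current_jump s0 sN.
  have [e e0 se] : exists2 e : R, (0 < e)%R & (s + e)%:E <= T n.+1 w.
    case: (T n.+1 w) Tn1 => [b| |]// sb; last by exists 1%R => //; rewrite leey.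
    by exists (b - s)%R; rewrite ?subr_gt0// addrC subrK.
  exists e => // r /andP[sr re].
  rewrite (@jump_processE r w n) ?(@jump_processE s w n)//.
    by rewrite (le_trans Tn).
  by rewrite (lt_le_trans _ se)// lte_fin.
have Ts n : T n w <= s%:E.
  by rewrite leNgt; apply/negP => sT; apply: expl; exists n.
exists 1%R => // r /andP[sr _]; rewrite !jump_process_None// => n.
by rewrite (le_trans (Ts n)).
Qed.

(* [N] bounds the number of jumps until [u], so that the sums over the jumps are
   finite. *)
Section before_explosion.
Variables (u : R) (w : Omega) (N : nat).
Hypotheses (u0 : (0 <= u)%R) (uN : u%:E < T N w).

Let a n := trunc_time tau u n w.

Let I n : set R := `[a n, a n.+1[%classic.

(* Truncating the jump times at [u] does not affect the times before [u]. *)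
Let in_I n r : (0 <= r < u)%R -> I n r <-> T n w <= r%:E < T n.+1 w.
Proof.
move=> /andP[r0 ru]; rewrite /I /= in_itv /= -lee_fin -lte_fin /a !trunc_timeE//.
by rewrite ge_min lt_min (lte_fin r) ru andbT [u%:E <= _]leNgt lte_fin ru orbF.
Qed.

Lemma path_sum (h : E -> R) r : (0 <= r < u)%R ->
  oapp h 0%R (Y r w) = (\sum_(n < N) h (X n w) * \1_(I n) r)%R.
Proof.
move=> rb; have /andP[r0 ru] := rb.
have rN : r%:E < T N w by rewrite (lt_trans _ uN)// lte_fin.
have [n nN Tn] := current_jump r0 rN.
have [Tn0 Tn1] := andP Tn.
rewrite (jump_processE Tn0 Tn1) /= (bigD1 (Ordinal nN))//= indicE mem_set; last first.
  exact/in_I.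
rewrite mulr1 big1 ?addr0// => -[k kN] /= kn.
rewrite indicE memNset ?mulr0// => /in_I => /(_ rb) /andP[Tk0 Tk1].
have := jump_time_supremum Tk0 Tk1; rewrite (jump_time_supremum Tn0 Tn1) => nk.
by move/negP: kn; apply; apply/eqP/val_inj; rewrite /= nk.
Qed.

Lemma path_integral (h : E -> R) :
  additive_functional Y h u w = (\sum_(n < N) h (X n w) * sojourn tau u n w)%R.
Proof.
rewrite /additive_functional /Rintegral.
pose F (n : 'I_N) r := (h (X n w))%:E * (\1_(I n) r)%:E.
have FE r : `[0%R, u[%classic r ->
    (oapp h 0%R (Y r w))%:E = \sum_(n < N) F n r.
  move=> /=; rewrite in_itv/= => rb; rewrite path_sum// -sumEFin.
  by apply: eq_bigr.
have iF n : lebesgue_measure.-integrable `[0%R, u[%classic (F n).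
  apply: (@integrableS _ _ _ _ setT) => //.
  by apply: integrableZl => //; exact: integrable_indic_itv.
have mF : measurable_fun `[0%R, u[%classic (fun r => \sum_(n < N) F n r).
  apply: emeasurable_sum => n; exact: (measurable_int _ (iF n)).
rewrite -integral_itv_bndo_bndc; last first.
  by apply: eq_measurable_fun mF => r; rewrite inE => /FE.
transitivity (fine (\int[lebesgue_measure]_(r in `[0%R, u[) \sum_(n < N) F n r)).
  by congr fine; apply: eq_integral => r; rewrite inE => /FE.
rewrite integral_sum// (eq_bigr (fun n : 'I_N => (h (X n w) * sojourn tau u n w)%:E)).
  by rewrite sumEFin.
move=> n _; rewrite /F integralZl//; last first.
  apply: (@integrableS _ _ _ _ setT) => //; exact: integrable_indic_itv.
rewrite integral_indic//; last exact: measurable_itv.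
rewrite EFinM; congr (_ * _).
have -> : I n `&` `[0%R, u[%classic = I n.
  apply/setIidPl => r; rewrite /I /= !in_itv /= => /andP[ar ra].
  rewrite (le_trans _ ar) ?trunc_time_ge0//= (lt_le_trans ra)//.
  exact: trunc_time_le.
rewrite /= lebesgue_measure_itv /= lte_fin; case: ltP => [_//|aa].
rewrite /sojourn; congr EFin; apply/eqP; rewrite eq_sym subr_eq0 eq_le aa /=.
exact: le_trunc_time.
Qed.

Lemma path_jumps (f : E -> R) :
  (oapp f 0 (Y u w) - f (X 0%N w) = \sum_(n < N)
    \1_[set v | (T n.+1 v <= u%:E)%E] w * (f (X n.+1 w) - f (X n w)))%R.
Proof.
have [m mN Tm] := current_jump u0 uN.
have [Tm0 Tm1] := andP Tm.
rewrite (jump_processE Tm0 Tm1) /=.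
have jumpedE n : (\1_[set v | (T n.+1 v <= u%:E)%E] w = (n < m)%:R :> R)%R.
  rewrite indicE; congr ((nat_of_bool _)%:R); apply/idP/idP; rewrite ?inE /=.
    move=> Tn; rewrite ltnNge; apply/negP => mn.
    by move: Tn; rewrite leNgt (lt_le_trans Tm1)// le_jump_time.
  by move=> nm; rewrite (le_trans _ Tm0)// le_jump_time.
under eq_bigr do rewrite jumpedE.
rewrite -(big_mkord xpredT (fun n => (n < m)%:R * (f (X n.+1 w) - f (X n w))))%R.
rewrite (big_cat_nat (n := m))//=; last exact: ltnW.
have -> : (\sum_(m <= n < N) (n < m)%:R * (f (X n.+1 w) - f (X n w)) = 0)%R.
  by rewrite big_nat big1// => n /andP[mn _]; rewrite ltnNge mn mul0r.
rewrite addr0 -(telescope_sumr (fun n => f (X n w)))//.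
by apply: eq_big_nat => n /andP[_ nm]; rewrite nm mul1r.
Qed.

End before_explosion.
End paths.

(** * The natural filtration *)

Section natural_filtration_theory.
Context {R : realType} d (E : measurableType d) d' (Omega : measurableType d').
Variables (X : nat -> Omega -> E) (tau : nat -> Omega -> \bar R).
Hypothesis mX : forall n, measurable_fun setT (X n).
Hypothesis mtau : forall n, measurable_fun setT (tau n).
Hypothesis tau_ge0 : forall n w, 0 <= tau n w.

Local Notation T := (jump_time tau).
Local Notation Y := (jump_process X tau).
Local Notation past n m := (g_sigma_algebraType (past_system X tau n m)).

(** The events that satisfy the conclusion form a sigma-algebra, so it suffices to
    consider events [Y_r \in B] with r <= s. On [s < T_(n+1)] the time r lies
    between two jumps T_k <= r < T_(k+1) with k <= n, and Y_r = X_k. *)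
Lemma natural_filtration_before_jump s n (A : set Omega) : (0 <= s)%R ->
  natural_filtration Y s A ->
  exists2 A', <<s past_system X tau n n >> A' &
    A `&` [set w | s%:E < T n.+1 w] = A' `&` [set w | s%:E < T n.+1 w].
Proof.
move=> s0; set before := [set w | s%:E < T n.+1 w].
suff : <<s \bigcup_(i in [set r | (0 <= r <= s)%R])
    preimage_set_system setT (Y i) [set Some @` B | B in measurable] >> `<=`
    [set A | exists2 A', <<s past_system X tau n n >> A' & A `&` before = A' `&` before].
  exact.
apply: smallest_sub.
  split.
  - by exists set0; [exact: (@measurable0 _ (past n n))|].
  - move=> B [B' sB' BB']; exists (setT `\` B').
      exact: (@measurableD _ (past n n) _ _ measurableT).
    rewrite !setTD; apply/seteqP; split => w [nB bw]; split => //= Bw; apply: nB.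
      have : (B' `&` before) w by [].
      by rewrite -BB' => -[].
    have : (B `&` before) w by [].
    by rewrite BB' => -[].
  - move=> B HB.
    have /choice[B' HB'] : forall k, exists B' : set Omega,
        <<s past_system X tau n n >> B' /\ B k `&` before = B' `&` before.
      by move=> k; have [B' ? ?] := HB k; exists B'.
    exists (\bigcup_k B' k).
      apply: (@bigcupT_measurable _ (past n n)) => k; exact: (HB' k).1.
    rewrite !setI_bigcupl; apply: eq_bigcupr => k _; exact: (HB' k).2.
move=> _ [r /andP[r0 rs] [_ [B mB <-] <-]]; rewrite setTI.
(* For [k = n] the constraint [r < T_(n+1)] is left out: it is implied by
   [s < T_(n+1)], and [T_(n+1)] does not belong to the past. *)
pose visit k : set (past n n) := [set w | T k w <= r%:E] `&`
  (if (k < n)%N then [set w | r%:E < T k.+1 w] else setT) `&` X k @^-1` B.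
exists (\bigcup_(k in `I_n.+1) visit k).
  apply: (@bigcup_measurable _ (past n n)) => k /= kn.
  have mT j : (j <= n)%N -> measurable_fun setT (T j : past n n -> \bar R).
    move=> jn; apply: measurable_jump_time => i /andP[i1 ij].
    by apply: measurable_past_hold; rewrite i1 (leq_trans ij).
  apply: measurableI; first apply: measurableI.
  - rewrite -[X in measurable X]setTI.
    by apply: (@measurable_lee _ _ _ setT measurableT (T k : past n n -> \bar R) (cst r%:E)) => //; exact: mT.
  - case: ifPn => // kn'; rewrite -[X in measurable X]setTI.
    by apply: (@measurable_lte _ _ _ setT measurableT (cst r%:E) (T k.+1 : past n n -> \bar R)) => //; exact: mT.
  - have mXk : measurable_fun setT (X k : past n n -> E).
      exact: measurable_past_chain.
    by rewrite -[X in measurable X]setTI; exact: mXk.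
apply/seteqP; split => w [].
  move=> [x Bx Yx] bw; split => //.
  have rn : r%:E < T n.+1 w by rewrite (le_lt_trans _ bw)// lee_fin.
  have [k kn /andP[Tk Tk1]] := current_jump r0 rn.
  exists k => //; split; first by split => //; case: ifP.
  by move: Yx; rewrite (jump_processE X tau_ge0 Tk Tk1) => -[xk]; rewrite /= -xk.
move=> [k /= kn [[Tk Tk1] Bk]] bw; split => //; exists (X k w) => //.
apply/esym/jump_processE => //; move: Tk1; case: ifPn => //.
rewrite -leqNgt => nk _; have -> : k = n by apply/eqP; rewrite eqn_leq nk -ltnS kn.
by rewrite (le_lt_trans _ bw)// lee_fin.
Qed.

Lemma natural_filtration_measurable s : natural_filtration Y s `<=` measurable.
Proof.
apply: smallest_sub; first exact: sigma_algebra_measurable.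
move=> _ [r /andP[r0 rs] [_ [B mB <-] <-]]; rewrite setTI.
rewrite (_ : _ @^-1` _ = \bigcup_k ([set w | T k w <= r%:E] `&`
  [set w | r%:E < T k.+1 w] `&` X k @^-1` B)).
  apply: bigcupT_measurable => k.
  have mT j : measurable_fun setT (T j) by exact: measurable_jump_time.
  apply: measurableI; first apply: measurableI.
  - rewrite -[X in measurable X]setTI.
    by apply: (@measurable_lee _ _ _ setT measurableT (T k) (cst r%:E)).
  - rewrite -[X in measurable X]setTI.
    by apply: (@measurable_lte _ _ _ setT measurableT (cst r%:E) (T k.+1)).
  - by rewrite -[X in measurable X]setTI; exact: mX.
apply/seteqP; split => w; last first.
  by move=> [k _ [[Tk Tk1] Bk]]; exists (X k w) => //; rewrite (jump_processE X tau_ge0 Tk Tk1).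
move=> [x Bx]; have [[N rN]|expl] := pselect (exists N, r%:E < T N w).
  have [k kn /andP[Tk Tk1]] := current_jump r0 rN.
  rewrite (jump_processE X tau_ge0 Tk Tk1) => -[xk].
  by exists k => //; split => //; rewrite /= -xk.
rewrite jump_process_None// => k.
by rewrite leNgt; apply/negP => rT; apply: expl; exists k.
Qed.

Section adapted.
Variable s : R.
Hypothesis s0 : (0 <= s)%R.

Local Notation filtered := (g_sigma_algebraType
  (\bigcup_(i in [set r | (0 <= r <= s)%R])
    preimage_set_system setT (Y i) [set Some @` B | B in measurable])).

Variable h : E -> R.
Hypothesis mh : measurable_fun setT h.

Lemma measurable_jump_process r : (0 <= r <= s)%R ->
  measurable_fun setT (fun w : filtered => oapp h 0%R (Y r w)).
Proof.
move=> rs _ B mB; rewrite setTI.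
have gen A : measurable A -> measurable (Y r @^-1` (Some @` A) : set filtered).
  move=> mA; apply: sub_gen_smallest; exists r => //; exists (Some @` A) => //.
    by exists A.
  by rewrite setTI.
have mA : measurable (Y r @^-1` (Some @` (h @^-1` B)) : set filtered).
  by apply: gen; rewrite -[X in measurable X]setTI; exact: mh.
have mN : measurable (~` (Y r @^-1` (Some @` setT)) : set filtered).
  by apply: measurableC; exact: gen.
have [B0|B0] := pselect (B 0%R).
  rewrite (_ : _ @^-1` _ = Y r @^-1` (Some @` (h @^-1` B)) `|`
      ~` (Y r @^-1` (Some @` setT))); first exact: measurableU.
  apply/seteqP; split => w /=; case: (Y r w) => [y|]/=.
  - by move=> By; left; exists y.
  - by move=> _; right; case.
  - by case=> [[x Bx [<-]]//|/= []]; exists y.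
  - by [].
rewrite (_ : _ @^-1` _ = Y r @^-1` (Some @` (h @^-1` B)))//.
apply/seteqP; split => w /=; case: (Y r w) => [y|]//=.
- by move=> By; exists y.
- by move=> [x Bx [<-]].
- by case.
Qed.

(** Progressive measurability is proved by discretization. Times are rounded up to
    a grid of mesh 1/(m+1) and capped at [s]: rounding up makes the values converge,
    since paths are constant to the right, and the cap keeps the rounded times
    within the reach of the filtration. *)
Let q (m k : nat) : R := Num.min s (k.+1%:R / m.+1%:R)%R.

Let rho (m : nat) (r : R) : R := q m (Num.truncn (r * m.+1%:R)%R).

Let q_itv m k : (0 <= q m k <= s)%R.
Proof. by rewrite le_min s0 divr_ge0//= ge_min lexx. Qed.

Let rho_ge m r : (0 <= r <= s)%R -> (r <= rho m r)%R.
Proof.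
move=> /andP[r0 rs]; rewrite /rho /q le_min rs /=.
have /truncn_itv/andP[_ /ltW rm] : (0 <= r * m.+1%:R)%R by exact: mulr_ge0.
by rewrite ler_pdivlMr.
Qed.

Let rho_le m r : (0 <= r <= s)%R -> (rho m r <= r + m.+1%:R^-1)%R.
Proof.
move=> /andP[r0 rs]; rewrite /rho /q ge_min; apply/orP; right.
have /truncn_itv/andP[rm _] : (0 <= r * m.+1%:R)%R by exact: mulr_ge0.
rewrite ler_pdivrMr// mulrDl mulVf// -natr1 lerD2r//.
Qed.

Let D : set (filtered * R) := setT `*` `[0%R, s]%classic.

Let mD : measurable D.
Proof. by apply: measurableX. Qed.

(** The rounded process is a countable sum of products of a function of the path and
    an indicator in time. *)
Let measurable_step m :
  measurable_fun D (fun z : filtered * R => oapp h 0%R (Y (rho m z.2) z.1)).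
Proof.
move=> _ B mB.
pose slot k : set R := `[0%R, s]%classic `&` `[(k%:R / m.+1%:R)%R, (k.+1%:R / m.+1%:R)%R[%classic.
pose hit k : set filtered := (fun w => oapp h 0%R (Y (q m k) w)) @^-1` B.
rewrite (_ : _ `&` _ = \bigcup_k (hit k `*` slot k)).
  apply: bigcupT_measurable => k; apply: measurableX.
    rewrite /hit -[X in measurable X]setTI; exact: (measurable_jump_process (q_itv m k)).
  by apply: measurableI; exact: measurable_itv.
have slotE k (r : R) : (0 <= r)%R -> (k%:R / m.+1%:R <= r < k.+1%:R / m.+1%:R)%R ->
    Num.truncn (r * m.+1%:R)%R = k.
  by move=> r0; rewrite ler_pdivrMr// ltr_pdivlMr// => /truncn_def.
apply/seteqP; split => -[w r] /=.
  move=> [[_ rs] Brw]; exists (Num.truncn (r * m.+1%:R)%R) => //; split => //.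
  split => //; rewrite /= in_itv /= ler_pdivrMr// ltr_pdivlMr//.
  by apply: truncn_itv; apply: mulr_ge0 => //; move: rs; rewrite /= ?in_itv/= => /andP[].
move=> [k _ [Bw [rs rk]]]; split => //; rewrite /rho (slotE k)//.
by move: rs; rewrite /= ?in_itv/= => /andP[].
Qed.

Let measurable_path :
  measurable_fun D (fun z : filtered * R => oapp h 0%R (Y z.2 z.1)).
Proof.
apply: (measurable_fun_cvg measurable_step) => -[w r] [_ /=]; rewrite in_itv/= => rs.
have [r0 _] := andP rs.
have [e e0 Ye] := jump_process_right X tau_ge0 w r0.
apply: (cvg_near_cst); near=> m.
congr (oapp h 0%R _); apply: Ye; rewrite rho_ge//=.
rewrite (le_lt_trans (rho_le m rs))// ltrD2l.
near: m; exact: near_infty_natSinv_lt (PosNum e0).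
Unshelve. all: by end_near. Qed.

(** Tonelli's theorem, on [Omega] with the sigma-algebra of the filtration at
    time [s]. *)
Lemma measurable_additive_functional :
  measurable_fun setT (additive_functional Y h s : filtered -> R).
Proof.
pose G (z : filtered * R) : \bar R := (((fun z => oapp h 0%R (Y z.2 z.1)) \_ D) z)%:E.
have mG : measurable_fun setT G.
  by apply/measurable_EFinP; exact: (measurable_restrictT _ mD).1 measurable_path.
rewrite (_ : additive_functional Y h s = fun w => fine
    (\int[lebesgue_measure]_r G^\+ (w, r) - \int[lebesgue_measure]_r G^\- (w, r))).
  apply: (measurableT_comp (fine_measurable measurableT)).
  apply: emeasurable_funB.
    apply: (measurable_fun_fubini_tonelli_F (m2 := lebesgue_measure) G^\+) => //.
    exact: measurable_funepos.
  apply: (measurable_fun_fubini_tonelli_F (m2 := lebesgue_measure) G^\-) => //.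
  exact: measurable_funeneg.
apply/funext => w; rewrite /additive_functional /Rintegral.
transitivity (fine (\int[lebesgue_measure]_r G (w, r))).
  congr fine; rewrite integral_mkcond; apply: eq_integral => r _.
  rewrite /G !patchE (_ : ((w, r) \in D) = (r \in `[0%R, s]%classic)); first by case: ifP.
  by apply/idP/idP; rewrite !inE /D /=; [case|].
rewrite integralE; congr (fine (_ - _)); apply: eq_integral => r _.
  by rewrite !funeposE.
by rewrite !funenegE.
Qed.

End adapted.
End natural_filtration_theory.

(** * The martingale property *)

Section jump_count_theory.
Context {R : realType} d (Omega : measurableType d) (tau : nat -> Omega -> \bar R).
Hypothesis tau_ge0 : forall n w, 0 <= tau n w.

Local Notation T := (jump_time tau).

(** As the jump times are nondecreasing, the first [N] indicators sum to the number
    of jumps until [u] among the first [N]. *)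
Let sum_jumped u w N : (0 <= u)%R ->
  exists2 k, T k w <= u%:E & \sum_(0 <= n < N) (\1_(jumped tau u n) w : R)%:E = k%:R%:E /\
    (T N w <= u%:E -> k = N).
Proof.
move=> u0; elim: N => [|N [k Tk [sk kN]]].
  by exists 0%N; rewrite ?jump_time0// big_geq.
rewrite big_nat_recr//= sk indicE.
have [Tu|uT] := leP (T N.+1 w) u%:E.
  have TN : T N w <= u%:E by rewrite (le_trans _ Tu)// le_jump_time.
  exists N.+1 => //; rewrite mem_set// -(kN TN) -EFinD; split => //.
  by rewrite natr1.
exists k => //; rewrite memNset; first by rewrite adde0.
by rewrite /jumped /=; apply/negP; rewrite -ltNge.
Qed.

Lemma jump_countE u w : (0 <= u)%R ->
  jump_count tau u w = \sum_(0 <= n <oo) (\1_(jumped tau u n) w : R)%:E.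
Proof.
move=> u0; apply/eqP; rewrite eq_le; apply/andP; split.
  apply: ge_ereal_sup => _ [n /= Tn <-].
  have [k _ [sk kn]] := sum_jumped w n u0.
  by rewrite -(kn Tn) -sk; apply: nneseries_lim_ge => m _ _; rewrite lee_fin.
apply: lime_le; first by apply: is_cvg_nneseries => n _ _; rewrite lee_fin.
apply: nearW => N; have [k Tk [-> _]] := sum_jumped w N u0.
by apply: ereal_sup_ubound; exists k.
Qed.

Lemma jump_count_fin u w : jump_count tau u w \is a fin_num ->
  exists N, u%:E < T N w.
Proof.
move=> fin; apply: contrapT => expl.
have Tu n : T n w <= u%:E by rewrite leNgt; apply/negP => uT; apply: expl; exists n.
have ub n : n%:R%:E <= jump_count tau u w by apply: ereal_sup_ubound; exists n => //=.
have := ub (Num.truncn (fine (jump_count tau u w))).+1; rewrite -{2}(fineK fin) lee_fin.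
apply/negP; rewrite -ltNge.
have c0 : (0 <= fine (jump_count tau u w))%R.
  by rewrite fine_ge0//; exact: (ub 0%N).
by have /andP[] := truncn_itv c0.
Qed.

End jump_count_theory.

Section martingale_property.
Context {R : realType} d (E : measurableType d) d' (Omega : measurableType d').
Variables (gamma : R.-pker E ~> E) (t : E * E -> R) (g : R -> R).
Hypotheses (mgt : measurable_fun setT (g \o t)) (gt_ge0 : forall z, (0 <= g (t z))%R).
Variables (X : nat -> Omega -> E) (tau : nat -> Omega -> \bar R).
Hypothesis mX : forall n, measurable_fun setT (X n).
Hypothesis mtau : forall n, measurable_fun setT (tau n).
Hypothesis tau_ge0 : forall n w, 0 <= tau n w.
Variables (x0 : E) (P : probability Omega R).
Hypothesis XtauP : is_lbmjp gamma t g X tau x0 P.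
Hypothesis count_finite : forall T : R, (0 < T)%R -> \int[P]_w jump_count tau T w < +oo.

Local Notation T := (jump_time tau).
Local Notation Y := (jump_process X tau).
Local Notation inc f := (increment gamma t g X tau f).

Let mjumped u n : measurable (jumped tau u n).
Proof. exact: measurable_jumped. Qed.

Let mind u n : measurable_fun setT (fun w => (\1_(jumped tau u n) w : R)%:E : \bar R).
Proof. by apply/measurable_EFinP; exact: measurable_indic. Qed.

Lemma sum_jumped_lty u : (0 <= u)%R -> \sum_(0 <= n <oo) P (jumped tau u n) < +oo.
Proof.
move=> u0; have u1 : (0 < u + 1)%R by rewrite ltr_wpDl.
apply: le_lt_trans (count_finite u1).
under eq_integral do rewrite jump_countE ?ltW//.
rewrite integral_nneseries//.
apply: lee_nneseries => [//|n _]; rewrite integral_indic// setIT.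
apply: le_measure; rewrite ?inE// => w; rewrite /jumped /= => /le_trans; apply.
by rewrite lee_fin lerDl.
Qed.

(** A finite expected number of jumps is finite almost surely. *)
Lemma nonexplosive u : {ae P, forall w, exists N, u%:E < T N w}.
Proof.
(* A positive horizon beyond [u]. *)
pose v := (Num.max u 0 + 1)%R.
have v0 : (0 < v)%R by rewrite ltr_wpDl// le_max lexx orbT.
have iv : P.-integrable setT (jump_count tau v).
  rewrite (_ : jump_count tau v =
      fun w => \sum_(0 <= n <oo) (\1_(jumped tau v n) w : R)%:E); last first.
    by apply/funext => w; rewrite jump_countE// ltW.
  apply/integrableP; split.
    by apply: ge0_emeasurable_sum => // n _ _ _; rewrite lee_fin.
  under eq_integral do rewrite gee0_abs ?nneseries_ge0//.
  under eq_integral do rewrite -jump_countE ?ltW//.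
  exact: count_finite.
have := integrable_ae measurableT iv; apply: filterS => w /(_ Logic.I).
move=> /(jump_count_fin)[N vN]; exists N; apply: le_lt_trans vN.
by rewrite lee_fin /v (@le_trans _ _ (Num.max u 0%R))// ?lerDl// le_max lexx.
Qed.

Section bounded_function.
Variables (f : E -> R) (c : R).
Hypotheses (mf : measurable_fun setT f) (fc : forall y, (0 <= f y <= c)%R).

Let c0 : (0 <= c)%R.
Proof. by have /andP[+] := fc point; exact: le_trans. Qed.

Let rate w n := fine (jump_rate gamma t g (X n w)).

Let step_bound u n w : R := (\1_(jumped tau u n) w + rate w n * sojourn tau u n w)%R.

Let step_bound_ge0 u n w : (0 <= step_bound u n w)%R.
Proof.
rewrite addr_ge0// mulr_ge0//.
  by rewrite fine_ge0// jump_rate_ge0.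
exact: sojourn_ge0.
Qed.

Let mstep_bound u n : measurable_fun setT (fun w => (step_bound u n w)%:E).
Proof.
apply/measurable_EFinP; apply: measurable_funD; first exact: measurable_indic.
apply: measurable_funM; last exact: measurable_sojourn.
apply: (measurableT_comp (fine_measurable measurableT)).
exact: measurableT_comp (measurable_jump_rate gamma mgt gt_ge0) (mX n).
Qed.

(** The dominating function for all partial sums; its mean is at most twice
    [c] times the expected number of jumps. *)
Let total_bound u w : \bar R := c%:E * \sum_(0 <= n <oo) (step_bound u n w)%:E.

Let total_bound_integrable u : (0 <= u)%R -> P.-integrable setT (total_bound u).
Proof.
move=> u0; apply: integrableZl => //; apply/integrableP; split.
  by apply: ge0_emeasurable_sum => // n w _ _; rewrite lee_fin step_bound_ge0.
under eq_integral.
  move=> w _; rewrite gee0_abs; last first.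
    by apply: nneseries_ge0 => n _ _; rewrite lee_fin step_bound_ge0.
  over.
rewrite integral_nneseries//; last by move=> n w _; rewrite lee_fin step_bound_ge0.
apply: (@le_lt_trans _ _ (2%:E * \sum_(0 <= n <oo) P (jumped tau u n))).
  rewrite -nneseriesZl//; apply: lee_nneseries => n _.
    by move=> _; apply: integral_ge0 => w _; rewrite lee_fin step_bound_ge0.
  exact: (expected_increment_bound mgt gt_ge0 mX mtau tau_ge0 XtauP u n).
by rewrite lte_mul_pinfty// sum_jumped_lty.
Qed.

Let partial u N w := (\sum_(n < N) inc f u n w)%R.

Let mpartial u N : measurable_fun setT (fun w => (partial u N w)%:E).
Proof.
apply/measurable_EFinP; apply: measurable_sum => n.
exact: measurable_increment.
Qed.

Let partial_bound u :
  {ae P, forall w, forall N, `|(partial u N w)%:E| <= total_bound u w}.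
Proof.
have := ae_foralln (increment_bound mgt gt_ge0 mX mtau tau_ge0 XtauP mf fc u).
apply: filterS => w incw N; rewrite /total_bound.
apply: (@le_trans _ _ (\sum_(0 <= n < N) (c * step_bound u n w)%:E)).
  by rewrite big_mkord sumEFin lee_fin (le_trans (ler_norm_sum _ _ _))// ler_sum.
rewrite -nneseriesZl; last by move=> n _; rewrite lee_fin step_bound_ge0.
under eq_bigr do rewrite EFinM.
by apply: nneseries_lim_ge => n _ _; rewrite mule_ge0// lee_fin step_bound_ge0.
Qed.

(* The process is only required to agree with the sum of the increments almost
   surely, which leaves the choice of its initial value. *)
Variable Z : R -> Omega -> R.
Hypothesis adaptedZ : forall s, (0 <= s)%R -> forall B : set R, measurable B ->
  natural_filtration Y s (Z s @^-1` B).
Hypothesis sumZ : forall s, (0 <= s)%R -> {ae P, forall w,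
  forall N, s%:E < T N w -> Z s w = partial s N w}.

Let mZ s : (0 <= s)%R -> measurable_fun setT (EFin \o Z s).
Proof.
move=> s0; apply/measurable_EFinP => _ B mB; rewrite setTI.
exact: (natural_filtration_measurable mX mtau tau_ge0 (adaptedZ s0 mB)).
Qed.

Let cvg_partial s : (0 <= s)%R ->
  {ae P, forall w, (partial s N w)%:E @[N --> \oo] --> (Z s w)%:E}.
Proof.
move=> s0; have := sumZ s0; have := nonexplosive s; apply: filterS2.
move=> w [N sN] Zw; apply: cvg_near_cst; exists N => // M /= NM.
by rewrite -Zw// (lt_le_trans sN)// le_jump_time.
Qed.

Let dominated s (A : set Omega) : (0 <= s)%R -> measurable A ->
  P.-integrable A (EFin \o Z s) /\
  \int[P]_(w in A) (partial s N w)%:E @[N --> \oo] --> \int[P]_(w in A) (Z s w)%:E.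
Proof.
move=> s0 mA.
have [iZ _ cvgZ] := @dominated_convergence _ _ _ P A mA
  (fun N w => (partial s N w)%:E) (EFin \o Z s) (total_bound s)
  (fun N => measurable_funTS (mpartial s N)) (measurable_funTS (mZ s0))
  ltac:(by have := cvg_partial s0; apply: filterS)
  (integrableS measurableT mA (@subsetT _ A) (total_bound_integrable s0))
  ltac:(by have := partial_bound s; apply: filterS => w Hw N _; exact: Hw).
by split.
Qed.

(** An increment whose jump has occurred by time [s] no longer changes. On
    the remaining event the set [A] may be replaced by an event [A'] of the past of
    the n-th jump, over which the increments at times [s] and [u] both have mean
    zero. *)
Let partial_martingale s u N A : (0 <= s <= u)%R -> natural_filtration Y s A ->
  \int[P]_(w in A) (partial u N w)%:E = \int[P]_(w in A) (partial s N w)%:E.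
Proof.
move=> /andP[s0 su] FA; have mA := natural_filtration_measurable mX mtau tau_ge0 FA.
have iinc v n (B : set Omega) : measurable B ->
    P.-integrable B (fun w => (inc f v n w)%:E).
  move=> mB; apply: (@integrableS _ _ _ _ setT) => //.
  exact: (increment_integrable mgt gt_ge0 mX mtau tau_ge0 XtauP mf fc v n).
have sumE v : \int[P]_(w in A) (partial v N w)%:E =
    \sum_(n < N) \int[P]_(w in A) (inc f v n w)%:E.
  rewrite -integral_sum//; last by move=> n; exact: iinc.
  by apply: eq_integral => w _; rewrite sumEFin.
rewrite !sumE; apply: eq_bigr => n _.
have [A' sA' AA'] := natural_filtration_before_jump tau_ge0 n s0 FA.
have mA' := past_measurable mX mtau sA'.
pose before := [set w | s%:E < T n.+1 w].
have frozen w : ~ before w -> inc f u n w = inc f s n w.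
  move=> /negP; rewrite -leNgt => Ts.
  have Tu : T n.+1 w <= u%:E by rewrite (le_trans Ts).
  rewrite /increment !indicE !mem_set//; congr (_ - _ * _)%R.
  have Tn : T n w <= T n.+1 w by rewrite le_jump_time.
  rewrite /sojourn /trunc_time !min_l//; exact: le_trans Tn _.
have mbefore : measurable before.
  rewrite -[X in measurable X]setTI.
  apply: (@measurable_lte _ _ _ setT measurableT (cst s%:E) (T n.+1)) => //.
  exact: measurable_jump_time.
have restrict (B : set Omega) : measurable B ->
    \int[P]_(w in B) (inc f u n w)%:E - \int[P]_(w in B) (inc f s n w)%:E =
    \int[P]_(w in B `&` before) ((inc f u n w)%:E - (inc f s n w)%:E).
  move=> mB; rewrite -integralB//; [|exact: iinc..].
  rewrite [LHS]integral_mkcond [RHS]integral_mkcond; apply: eq_integral => w _.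
  rewrite !patchE; case: (asboolP (before w)) => [bw|nbw].
    have -> : (w \in B `&` before) = (w \in B).
      by apply/idP/idP; rewrite !inE; [case|split].
    by case: ifPn.
  rewrite [X in _ = X]ifN; last by rewrite notin_setE => -[].
  by case: ifPn => // _; rewrite /= frozen// subee.
have fin v : \int[P]_(w in A) (inc f v n w)%:E \is a fin_num.
  by apply: integrable_fin_num => //; exact: iinc.
have := restrict _ mA; rewrite AA' -(restrict _ mA').
rewrite !(expected_increment mgt gt_ge0 mX mtau tau_ge0 XtauP mf fc _ sA').
rewrite sube0 -(fineK (fin u)) -(fineK (fin s)) -EFinB => -[] /eqP.
by rewrite subr_eq0 => /eqP ->.
Qed.

(** Dominated convergence in [partial_martingale]. *)
Lemma martingale_of_increments : martingale P (natural_filtration Y) Z.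
Proof.
split; first exact: adaptedZ.
  by move=> s s0; exact: (dominated s0 measurableT).1.
move=> s u su A FA; have /andP[s0 us] := su.
have u0 := le_trans s0 us.
have mA := natural_filtration_measurable mX mtau tau_ge0 FA.
have [_ cu] := dominated u0 mA; have [_ cs] := dominated s0 mA.
have us_seq : (fun N => \int[P]_(w in A) (partial u N w)%:E) =
    (fun N => \int[P]_(w in A) (partial s N w)%:E).
  by apply/funext => N; exact: partial_martingale.
rewrite us_seq in cu.
exact: (cvg_unique (@ereal_hausdorff R) cu cs).
Qed.

End bounded_function.
End martingale_property.

(** * The Dynkin martingale *)

Section dynkin_martingale.
Context {R : realType} d (E : measurableType d) d' (Omega : measurableType d').
Variables (gamma : R.-pker E ~> E) (t : E * E -> R) (g : R -> R).
Hypotheses (mgt : measurable_fun setT (g \o t)) (gt_ge0 : forall z, (0 <= g (t z))%R).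
Variables (X : nat -> Omega -> E) (tau : nat -> Omega -> \bar R).
Hypothesis mX : forall n, measurable_fun setT (X n).
Hypothesis mtau : forall n, measurable_fun setT (tau n).
Hypothesis tau_ge0 : forall n w, 0 <= tau n w.
Variables (x0 : E) (P : probability Omega R).
Hypothesis XtauP : is_lbmjp gamma t g X tau x0 P.
Hypothesis count_finite : forall T : R, (0 < T)%R -> \int[P]_w jump_count tau T w < +oo.
Variables (f : E -> R) (M : R).
Hypotheses (mf : measurable_fun setT f) (fM : forall y, (`|f y| <= M)%R).

Local Notation T := (jump_time tau).
Local Notation Y := (jump_process X tau).
Local Notation rate := (jump_rate gamma t g).
Local Notation past n m := (g_sigma_algebraType (past_system X tau n m)).
Local Notation filtered s := (g_sigma_algebraType
  (\bigcup_(i in [set r | (0 <= r <= s)%R])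
    preimage_set_system setT (Y i) [set Some @` B | B in measurable])).

(** At infinite rate the embedded kernel is a Dirac mass. The conclusion is on the
    values of [f] and not on the states, as equality of states need not be a
    measurable event. *)
Let infinite_rate_stays n :
  {ae P, forall w, rate (X n w) = +oo -> f (X n.+1 w) = f (X n w)}.
Proof.
pose trapped : set (past n n.+1) := ~` finite_rate gamma t g X n.
have mtrapped : measurable trapped by apply: measurableC; exact: measurable_finite_rate.
pose Phi (z : past n n.+1 * E) : \bar R :=
  (\1_trapped z.1 * `|f z.2 - f (X n z.1)|)%:E.
have Phi0 z : 0 <= Phi z by rewrite lee_fin mulr_ge0.
have mfX : measurable_fun setT (fun z : past n n.+1 * E => f (X n z.1)).
  apply: (@measurableT_comp _ _ _ _ _ _ (fun w : past n n.+1 => f (X n w)) _ fst) => //.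
  apply: (@measurableT_comp _ _ _ _ _ _ f _ (X n : past n n.+1 -> E)) => //.
  exact: measurable_past_chain.
have mPhi : measurable_fun setT Phi.
  apply/measurable_EFinP; apply: measurable_funM.
    by apply: measurableT_comp => //; exact: measurable_indic.
  apply: measurableT_comp => //; apply: measurable_funB => //.
  exact: measurableT_comp.
have := ge0_expectation_chain mgt gt_ge0 mX mtau XtauP Phi0 mPhi.
rewrite [RHS]integral0_eq; last first.
  move=> w _; have [tw|tw] := pselect (trapped w); last first.
    by apply: integral0_eq => y _; rewrite /Phi /= indicE memNset// mul0r.
  rewrite (@integral_jump_kernel_degenerate _ _ _ gamma t g mgt gt_ge0 (X n w)
    (fun y => Phi (w, y))).
  - by rewrite /Phi /= subrr normr0 mulr0.
  - exact: (measurableT_comp mPhi (pair1_measurable (w : past n n.+1))).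
  - by move: tw; rewrite /trapped /finite_rate /= => /negP/negbTE ->; rewrite andbF.
have mPhiX : measurable_fun setT (fun w => Phi (w, X n.+1 w)).
  apply: (measurableT_comp mPhi); apply: measurable_fun_pair => //.
  exact: measurable_past_id.
move=> intPhi0.
have : ae_eq P setT (fun w => Phi (w, X n.+1 w)) (cst 0).
  apply/(ae_eq_integral_abs _ _ mPhiX) => //.
  by rewrite -[RHS]intPhi0; apply: eq_integral => w _; rewrite gee0_abs.
apply: filterS => w /= /(_ Logic.I) + roo; rewrite /Phi /= indicE mem_set; last first.
  by rewrite /trapped /finite_rate /= roo ltxx.
by rewrite mul1r => -[/eqP]; rewrite normr_eq0 subr_eq0 => /eqP.
Qed.

(** With horizon zero, the sojourns vanish, hence so does what they compensate. *)
Let no_instant_jump n :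
  {ae P, forall w, rate (X n w) < +oo -> ~ jumped tau 0 n w}.
Proof.
have mf' : measurable (finite_rate gamma t g X n : set Omega).
  apply: (@past_measurable _ _ _ _ _ X tau mX mtau n n).
  exact: measurable_finite_rate.
have mJ : measurable (jumped tau 0 n) by exact: measurable_jumped.
have := @expected_sojourn _ _ _ _ _ _ _ _ mgt gt_ge0 _ _ mX mtau tau_ge0 _ _ XtauP
  0%R n (cst 1) (fun=> lee01) (measurable_cst _).
rewrite integral0_eq => [intJ|w _]; last first.
  rewrite /= (_ : sojourn tau 0 n w = 0%R) ?mulr0 ?mule0//.
  by apply/eqP; rewrite eq_le sojourn_ge0// sojourn_le.
pose I w : \bar R := (\1_(finite_rate gamma t g X n) w * \1_(jumped tau 0 n) w)%:E.
have mI : measurable_fun setT I.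
  by apply/measurable_EFinP; apply: measurable_funM; exact: measurable_indic.
have : ae_eq P setT I (cst 0).
  apply/(ae_eq_integral_abs _ _ mI) => //; rewrite [RHS]intJ.
  by apply: eq_integral => w _; rewrite gee0_abs ?lee_fin ?mulr_ge0// /cst mul1e.
apply: filterS => w /(_ Logic.I) Iw rw Jw; move: Iw.
rewrite /I !indicE !mem_set//= mulr1 => -[] /eqP; by rewrite oner_eq0.
Qed.

(** Jumps at time zero occur only from states of infinite rate, and these jumps do
    not change the value of [f]. *)
Lemma initial_value : {ae P, forall w, oapp f 0%R (Y 0%R w) = f (X 0%N w)}.
Proof.
have := nonexplosive mtau tau_ge0 count_finite 0%R.
have := ae_foralln infinite_rate_stays; have := ae_foralln no_instant_jump.
apply: filterS3 => w finJ infX [N N0]; apply/eqP; rewrite -subr_eq0.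
rewrite (path_jumps X tau_ge0 (lexx 0%R) N0 f) big1// => n _.
have [rw|] := ltP (rate (X n w)) +oo.
  by rewrite indicE memNset ?mul0r//; exact: finJ.
by rewrite leye_eq => /eqP/infX ->; rewrite subrr mulr0.
Qed.

(** Adding the constant [M] to [f] makes it nonnegative and changes neither the
    generator nor the increments. The initial value [b] is either the constant f(x)
    or f(Y_0): the first gives the martingale started from x, the second the weak
    generator. *)
Lemma dynkin_martingale (b : Omega -> R) :
  {ae P, forall w, b w = f (X 0%N w)} ->
  (forall s, (0 <= s)%R -> measurable_fun setT (b : filtered s -> R)) ->
  martingale P (natural_filtration Y) (fun s w =>
    oapp f 0%R (Y s w) - b w - additive_functional Y (generator gamma t g f) s w)%R.
Proof.
move=> bX mb; pose f' y := (f y + M)%R.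
have f'b y : (0 <= f' y <= M + M)%R.
  have := fM y; rewrite ler_norml => /andP[f1 f2].
  by rewrite /f' -lerBlDr sub0r f1 lerD2r.
have mf' : measurable_fun setT f' by exact: measurable_funD.
have genE : generator gamma t g f' = generator gamma t g f.
  apply/funext => y; rewrite /generator /Rintegral; congr fine.
  by apply: eq_integral => z _; rewrite /f'; congr EFin; ring.
apply: (martingale_of_increments mgt gt_ge0 mX mtau tau_ge0 XtauP count_finite mf' f'b).
  move=> s s0 B mB.
  suff : measurable_fun setT (fun w : filtered s => oapp f 0%R (Y s w) - b w -
      additive_functional Y (generator gamma t g f) s w)%R.
    by move=> /(_ measurableT B mB); rewrite setTI.
  apply: measurable_funB; last first.
    by apply: measurable_additive_functional => //; exact: measurable_generator.
  apply: measurable_funB; last exact: mb.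
  by apply: measurable_jump_process => //; rewrite s0 lexx.
move=> s s0; move: bX; apply: filterS => w bw N sN.
rewrite bw (path_jumps X tau_ge0 s0 sN) (path_integral X tau_ge0 s0 sN) -sumrB.
apply: eq_bigr => n _; rewrite /increment genE /jumped /f'.
by congr (_ * _ - _)%R; ring.
Qed.

End dynkin_martingale.

Theorem theorem2p3 (R : realType) (E : completePseudoMetricType R)
    (E_hausdorff : hausdorff_space E) (E_separable : separable_space E)
    (pi : probability (borel E) R) (gamma : R.-pker (borel E) ~> (borel E))
    (t : borel E * borel E -> R) (t_ratio : is_balance_ratio pi gamma t)
    (g : R -> R) (g_balancing : balancing_function g)
    (d : measure_display) (Omega : measurableType d)
    (P : borel E -> probability Omega R)
    (X : nat -> Omega -> borel E) (tau : nat -> Omega -> \bar R)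
    (X_measurable : forall n, measurable_fun setT (X n))
    (tau_measurable : forall n, measurable_fun setT (tau n))
    (tau_ge0 : forall n w, 0 <= tau n w)
    (XtauP : forall x, msupport pi x -> is_lbmjp gamma t g X tau x (P x))
    (rate_gt0 : forall x, msupport pi x -> 0 < jump_rate gamma t g x)
    (g_nondecreasing :
      {in `[0%R, +oo[ &, {homo g : s u / (s <= u)%R}})
    (g_continuous : {within `[0%R, +oo[%classic, continuous g})
    (irreducible : exists2 phi : {measure set (borel E) -> \bar R},
      phi setT != 0 &
      forall x (B : set (borel E)), msupport pi x -> measurable B ->
        0 < phi B -> exists n, 0 < P x (X n @^-1` B))
    (abs_continuous : forall x (A : set (borel E)), msupport pi x ->
      measurable A -> pi A = 0 -> embedded_kernel gamma t g x A = 0)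
    (S : set (borel E)) (S_measurable : measurable S) (S_full : pi S = 1)
    (count_finite : forall (T : R) x, (0 < T)%R -> (msupport pi `&` S) x ->
      \int[P x]_w jump_count tau T w < +oo) :
  let Y := jump_process X tau in
  let L := generator gamma t g in
  let S0 := msupport pi `&` S in
  [/\ forall f, bounded_measurable R (borel E) f -> forall x, S0 x ->
        martingale (P x) (natural_filtration Y) (fun s w =>
          oapp f 0%R (Y s w) - f x - additive_functional Y (L f) s w)%R,
      bounded_measurable R (borel E) `<=` weak_domain P Y S0 &
      forall f, bounded_measurable R (borel E) f -> weak_generator P Y S0 f (L f)].
Proof.
move=> Y L S0.
have [mt t0 _ _] := t_ratio.
have gt_ge0 z : (0 <= g (t z))%R.
  have := t0 z; rewrite le_eqVlt => /orP[/eqP <-|tz].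
    by rewrite (balancing0 g_balancing).
  exact/ltW/(balancing_gt0 g_balancing).
have mgt : measurable_fun setT (g \o t).
  apply: (measurable_comp _ _ (balancing_measurable g_balancing) mt) => //.
  by move=> _ [z _ <-]; rewrite /= in_itv/= t0.
have mart f (b : Omega -> R) x : bounded_measurable R (borel E) f -> S0 x ->
    {ae P x, forall w, b w = f (X 0%N w)} ->
    (forall s, (0 <= s)%R -> measurable_fun setT (b : g_sigma_algebraType
      (\bigcup_(i in [set r | (0 <= r <= s)%R])
        preimage_set_system setT (Y i) [set Some @` B | B in measurable]) -> R)) ->
    martingale (P x) (natural_filtration Y) (fun s w =>
      oapp f 0%R (Y s w) - b w - additive_functional Y (L f) s w)%R.
  move=> [mf [M [_ fM]]] [sx Sx] bX mb.
  have count_x T : (0 < T)%R -> \int[P x]_w jump_count tau T w < +oo.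
    by move=> T0; exact: count_finite.
  have fM1 y : (`|f y| <= M + 1)%R by apply: fM => //; rewrite ltrDl.
  exact: (dynkin_martingale mgt gt_ge0 X_measurable tau_measurable tau_ge0
    (XtauP x sx) count_x mf fM1 bX mb).
have generatorP f : bounded_measurable R (borel E) f -> weak_generator P Y S0 f (L f).
  move=> bf x Sx; apply: mart => //.
    apply: (initial_value mgt gt_ge0 X_measurable tau_measurable tau_ge0
      (XtauP x Sx.1)); first by move=> T T0; exact: count_finite.
    by case: bf.
  move=> s s0; apply: measurable_jump_process; first by case: bf.
  by rewrite lexx s0.
split.
- move=> f bf x Sx; apply: (mart f (cst (f x))) => //.
  by have := lbmjp_start (XtauP x Sx.1); apply: filterS => w ->.
- by move=> f bf; exists (L f); exact: generatorP.
- exact: generatorP.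
Qed.
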